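(* Let $0 \le \varepsilon_1 < \varepsilon_2 \le 1$, $\delta\in(0,1)$ and $k\in\mathbb{N}$. There is an algorithm which, given (controlled) query access to the time evolution operator $e^{-iHt}$ of an $n$-qubit Hamiltonian $H$ (with $\|H\|_\infty\le1$) and to its inverse $e^{iHt}$, decides with probability at least $1-\delta$ whether $H$ is (1) within normalized Frobenius distance $\varepsilon_1$ of some $k$-local Hamiltonian or (2) at normalized Frobenius distance at least $\varepsilon_2$ from all $k$-local Hamiltonians (promised one holds). The algorithm uses $O\!\left(\frac{\log(1/\delta)}{(\varepsilon_2-\varepsilon_1)^2}\right)$ non-adaptive queries to the time evolution operator and its inverse, with $O\!\left(\frac{\log(1/\delta)}{\varepsilon_2-\varepsilon_1}\right)$ total evolution time.
   Context: An $n$-qubit Hamiltonian is a $2^n\times 2^n$ Hermitian matrix with $\|H\|_\infty\le1$. The $n$-qubit Paulis are $\{I,X,Y,Z\}^{\otimes n}$ with weight $|P|$ the number of non-identity factors; writing $H=\sum_P\alpha_PP$, $H$ is $k$-local if $\alpha_P=0$ whenever $|P|>k$. The normalized Frobenius norm is $\|A\|_2=\sqrt{\mathrm{tr}(A^\dagger A)/2^n}$; distance to $k$-local is $\min_K\|H-K\|_2$ over $k$-local $K$. A query applies $e^{-iHt}$ or $e^{iHt}$ (for $t\ge0$, possibly controlled on an ancilla); total evolution time is the sum of the $t$'s used. *)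

(* Defs.v *)
From HB Require Import structures.
From mathcomp Require Import all_boot all_order all_algebra.
From mathcomp Require Import all_classical all_reals all_analysis.
From mathcomp Require Import complex.
Set Implicit Arguments. Unset Strict Implicit. Unset Printing Implicit Defensive.
Import Order.TTheory GRing.Theory Num.Theory.
Import numFieldNormedType.Exports.
Local Open Scope ring_scope.

Section QuantumDefs.
Variable R : realType.
Local Notation C := (R[i]).

Definition iC : C := Complex 0 1.

Definition abs2 (z : C) : R := complex.Re z ^+ 2 + complex.Im z ^+ 2.

Definition adjmx m p (A : 'M[C]_(m, p)) : 'M[C]_(p, m) := map_mx (@conjc R) A^T.

Definition is_hermitian m (A : 'M[C]_m) : Prop := adjmx A = A.
Definition is_unitary m (U : 'M[C]_m) : Prop := U *m adjmx U = 1%:M.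

Definition vnorm2 m (v : 'cV[C]_m) : R := \sum_(i < m) abs2 (v i 0).

Definition opnorm_le1 m (H : 'M[C]_m) : Prop :=
  forall v : 'cV[C]_m, vnorm2 (H *m v) <= vnorm2 v.

Definition nfrob n (A : 'M[C]_(2 ^ n)) : R :=
  Num.sqrt (complex.Re (\tr (adjmx A *m A)) / (2 ^ n)%:R).

(* entries of the single-qubit Paulis I (0), X (1), Y (2), Z (3) *)
Definition pauli1_entry (a : nat) (x y : bool) : C :=
  match a with
  | 0 => if x == y then 1 else 0
  | 1 => if x == y then 0 else 1
  | 2 => if x == y then 0 else (if x then iC else - iC)   (* Y = [[0,-i],[i,0]] *)
  | _ => if x == y then (if x then -1 else 1) else 0
  end.

Definition bit (j x : nat) : bool := odd (x %/ 2 ^ j).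

Definition pstring n := {ffun 'I_n -> 'I_4}.

Definition pauli n (P : pstring n) : 'M[C]_(2 ^ n) :=
  \matrix_(x, y) \prod_(j < n) pauli1_entry (P j) (bit j x) (bit j y).

Definition pweight n (P : pstring n) : nat := #|[set j | P j != ord0]|.

Definition klocal n (k : nat) (K : 'M[C]_(2 ^ n)) : Prop :=
  exists alpha : pstring n -> C,
    K = \sum_(P : pstring n) alpha P *: pauli P /\
    forall P, (k < pweight P)%N -> alpha P = 0.

Definition mxpow m (A : 'M[C]_m) (j : nat) : 'M[C]_m := iter j (mulmx A) 1%:M.

Definition exp_partial m (A : 'M[C]_m) (N : nat) : 'M[C]_m :=
  \sum_(j < N) ((j`!)%:R)^-1 *: mxpow A j.

Definition expmx m (A : 'M[C]_m) : 'M[C]_m :=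
  \matrix_(i, j) Complex (limn (fun N => complex.Re (exp_partial A N i j)))
                         (limn (fun N => complex.Im (exp_partial A N i j))).

Definition evol m (H : 'M[C]_m) (t : R) : 'M[C]_m := expmx ((- (iC * (t%:C)%C)) *: H).
Definition evol_inv m (H : 'M[C]_m) (t : R) : 'M[C]_m := expmx ((iC * (t%:C)%C) *: H).

(* A query: apply e^{-iHt} (q_inv = false) or e^{iHt} (q_inv = true) to the
   system register, optionally controlled on the ancilla being in a basis
   state from the set given by q_ctrl. *)
Record query (d : nat) := Query {
  q_time : R;
  q_inv : bool;
  q_ctrl : option {set 'I_d} }.

(* Joint states of system (2^n) and ancilla (d) are stored as 2^n x d matrices. *)
Definition ctrl_proj d (S : {set 'I_d}) : 'M[C]_d :=
  diag_mx (\row_(j < d) (if j \in S then 1 else 0)).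

Definition apply_query n d (H : 'M[C]_(2 ^ n)) (q : query d)
    (psi : 'M[C]_(2 ^ n, d)) : 'M[C]_(2 ^ n, d) :=
  let U := if q_inv q then evol_inv H (q_time q) else evol H (q_time q) in
  match q_ctrl q with
  | None => U *m psi
  | Some Sc => U *m psi *m ctrl_proj Sc + psi *m (1%:M - ctrl_proj Sc)
  end.

Definition apply_unitary n d (W : 'M[C]_(2 ^ n * d)) (psi : 'M[C]_(2 ^ n, d))
  : 'M[C]_(2 ^ n, d) := vec_mx (mxvec psi *m W).

(* A non-adaptive algorithm: a fixed circuit, independent of H: starting from
   init, alternate H-independent unitaries and queries, apply a final is_unitary,
   measure in the computational basis and accept iff the outcome is in accept.
   Accepting means answering "case (1)". *)
Record algorithm (n : nat) := Algorithm {
  adim : nat;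
  init : 'M[C]_(2 ^ n, adim);
  steps : seq ('M[C]_(2 ^ n * adim) * query adim);
  final : 'M[C]_(2 ^ n * adim);
  accept : {set 'I_(2 ^ n * adim)} }.

Definition valid_algorithm n (A : algorithm n) : Prop :=
  \sum_(i < 2 ^ n) \sum_(j < adim A) abs2 (init A i j) = 1 /\
  is_unitary (final A) /\
  foldr (fun s acc => (is_unitary s.1 /\ 0 <= q_time s.2) /\ acc) True (steps A).

Definition run n (A : algorithm n) (H : 'M[C]_(2 ^ n)) : 'M[C]_(2 ^ n, adim A) :=
  foldl (fun psi s => apply_query H s.2 (apply_unitary s.1 psi)) (init A) (steps A).

Definition accept_prob n (A : algorithm n) (H : 'M[C]_(2 ^ n)) : R :=
  \sum_(o in accept A) abs2 ((mxvec (run A H) *m final A) 0 o).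

Definition num_queries n (A : algorithm n) : nat := size (steps A).

Definition total_time n (A : algorithm n) : R :=
  \sum_(s <- steps A) q_time s.2.

End QuantumDefs.

(* Main.v *)
Require Import Defs.
From HB Require Import structures.
From mathcomp Require Import all_boot all_order all_algebra all_solvable all_field.
From mathcomp Require Import all_classical all_reals all_analysis.
From mathcomp Require Import complex.
From mathcomp Require Import ring lra zify.
Set Implicit Arguments. Unset Strict Implicit. Unset Printing Implicit Defensive.
Import Order.TTheory GRing.Theory Num.Theory.
Import numFieldNormedType.Exports.
Local Open Scope ring_scope.

(* Send half of a maximally entangled pair through U = exp(-iHt), i.e. work with the
   matrix U / sqrt(2^n) itself.  Its component outside the span of the k-local Paulis
   has norm a with |a - t dist(H, k-local)| <= t^2.  The component is the sine of half
   the angle of a Grover rotation made of two H-independent reflections, U and U^-1.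
   Phase estimation of that rotation separates a <= a1 from a >= a2 with
   O(1/(a2 - a1)) queries; for t of order eps2 - eps1 the gap a2 - a1 is of order
   t (eps2 - eps1), which gives the stated number of queries and total time.

   To reach error delta coherently, the clock register carries as amplitudes the
   coefficients of (1 + x + ... + x^(L-1))^r with r = O(log(1/delta)).  The modulus of
   this window is a power of the Dirichlet kernel, at most L/2 for phases whose chord
   is at least 4/L, and Parseval turns this into the tail bound r / 4^(r-1). *)

(** * Phase estimation with a Dirichlet window *)

Section RootsOfUnity.
Variables (C : numClosedFieldType) (N : nat) (w : C).
Hypothesis N_gt0 : (0 < N)%N.
Hypothesis w_prim : N.-primitive_root w.

Lemma norm_unity_root n (z : C) : (0 < n)%N -> z ^+ n = 1 -> `|z| = 1.
Proof.
move=> n_gt0 zn1; apply/eqP; rewrite -(@pexpr_eq1 _ `|z| n) // -normrX zn1.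
by rewrite normr1.
Qed.

(** ['X^n - 1] is separable in characteristic zero, so it splits with [n] distinct roots, and [n]
    distinct [n]-th roots of unity always include a primitive one. *)
Lemma closed_prim_root_exists n : (0 < n)%N -> exists z : C, n.-primitive_root z.
Proof.
pose p : {poly C} := 'X^n - 1; have [r Dp] := closed_field_poly_normal p.
move=> n_gt0; rewrite (monicP _) ?monicXnsubC // scale1r in Dp.
have rn1: all n.-unity_root r by apply/allP=> z; rewrite -root_prod_XsubC -Dp.
have sz_r: (n < (size r).+1)%N.
  by rewrite -(size_prod_XsubC r id) -Dp size_XnsubC.
have [|z] := hasP (has_prim_root n_gt0 rn1 _ sz_r); last by exists z.
by rewrite -separable_prod_XsubC -Dp separable_Xn_sub_1 // pnatr_eq0 -lt0n.
Qed.

Lemma norm_root : `|w| = 1.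
Proof. exact: norm_unity_root N_gt0 (prim_expr_order w_prim). Qed.

Lemma sum_unity_root (x : C) : x ^+ N = 1 ->
  \sum_(m < N) x ^+ m = if x == 1 then N%:R else 0.
Proof.
move=> xN; case: eqP => [->|/eqP x1].
  under eq_bigr do rewrite expr1n.
  by rewrite sumr_const card_ord.
have /eqP := subrX1 x N; rewrite xN subrr eq_sym mulf_eq0 subr_eq0 (negPf x1).
by move=> /eqP.
Qed.

(** The sum is geometric with ratio [w ^+ j * w ^- k], an [N]-th root of unity that equals 1 only
    for [j = k], both exponents being below [N]. *)
Lemma dft_orthogonality (j k : nat) : (j < N)%N -> (k < N)%N ->
  \sum_(m < N) w ^+ (j * m) * (w ^+ (k * m))^* = if j == k then N%:R else 0.
Proof.
move=> jN kN.
have w0 : w != 0 by rewrite -normr_gt0 norm_root.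
have wV : w^* = w^-1 by rewrite invC_norm norm_root expr1n invr1 mul1r.
have -> : \sum_(m < N) w ^+ (j * m) * (w ^+ (k * m))^*
        = \sum_(m < N) (w ^+ j * w ^- k) ^+ m.
  apply: eq_bigr => m _.
  by rewrite rmorphXn /= wV exprMn -!exprM exprVn [in RHS]exprVn -exprM.
rewrite sum_unity_root; last first.
  rewrite exprMn exprVn -!exprM ![(_ * N)%N]mulnC !exprM (prim_expr_order w_prim).
  by rewrite !expr1n invr1 mulr1.
congr (if _ then _ else _).
have wk0 : w ^+ k != 0 by rewrite expf_neq0.
rewrite -(inj_eq (mulIf wk0)) -mulrA mulVf // mulr1 mul1r.
by rewrite (eq_prim_root_expr w_prim) /eqn !modn_small.
Qed.

(** Two lengths are used later: [n = N] for the full window, and [n = L < N] or [n = L = N] for a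
    bare Dirichlet kernel inside the larger transform. *)
Lemma dft_parseval n (f : nat -> C) : (n <= N)%N ->
  \sum_(m < N) `|\sum_(j < n) f j * w ^+ (j * m)| ^+ 2
  = N%:R * \sum_(j < n) `|f j| ^+ 2.
Proof.
move=> nN.
transitivity (\sum_(j < n) \sum_(k < n)
   f j * (f k)^* * \sum_(m < N) w ^+ (j * m) * (w ^+ (k * m))^*).
  rewrite exchange_big /=.
  transitivity (\sum_(m < N) \sum_(k < n) \sum_(j < n)
     f j * (f k)^* * (w ^+ (j * m) * (w ^+ (k * m))^*)).
    apply: eq_bigr => m _; rewrite normCK rmorph_sum mulr_sumr.
    apply: eq_bigr => k _; rewrite mulr_suml; apply: eq_bigr => j _.
    by rewrite rmorphM /= mulrACA.
  rewrite exchange_big; apply: eq_bigr => k _ /=.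
  rewrite exchange_big; apply: eq_bigr => j _ /=.
  by rewrite mulr_sumr.
rewrite mulr_sumr; apply: eq_bigr => j _.
have jN k : (k < n)%N -> (k < N)%N by move=> kn; apply: leq_trans nN.
rewrite (bigD1 j) //= dft_orthogonality ?jN // eqxx.
rewrite [X in _ + X]big1 ?addr0 => [|k kj]; first by rewrite normCK mulrC.
rewrite dft_orthogonality ?jN //.
by rewrite (inj_eq val_inj) eq_sym (negPf kj) mulr0.
Qed.

End RootsOfUnity.

(** * The clock amplitudes: powers of the Dirichlet kernel and their tails *)

Section ClockWindow.
Variable C : numClosedFieldType.
Variables L r : nat.
Hypothesis L_gt0 : (0 < L)%N.
Hypothesis r_gt0 : (0 < r)%N.

Definition dirichlet_poly : {poly C} := \sum_(i < L) 'X^i.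
Definition window (j : nat) : C := (dirichlet_poly ^+ r)`_j.
(** For [L > 0] the polynomial [dirichlet_poly ^+ r] has degree [(L - 1) r]; the clock has one basis
    state per coefficient. *)
Definition clock_size := (L.-1 * r).+1.
Definition window_norm2 : C := \sum_(j < clock_size) `|window j| ^+ 2.

Lemma dirichlet_polyE x : dirichlet_poly.[x] = \sum_(i < L) x ^+ i.
Proof. by rewrite horner_sum; apply: eq_bigr => i _; rewrite hornerXn. Qed.

Lemma window_sum x :
  \sum_(j < clock_size) window j * x ^+ j = (\sum_(i < L) x ^+ i) ^+ r.
Proof.
rewrite -dirichlet_polyE -horner_exp; apply/esym/horner_coef_wide.
apply: (leq_trans (size_exp_leq _ _)); rewrite ltnS leq_mul2r; apply/orP; right.
have : (size dirichlet_poly <= L)%N.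
  apply: (leq_trans (size_sum _ _ _)); apply/bigmax_leqP => i _.
  by rewrite size_polyXn.
by case: (size _) => //= s; case: L L_gt0.
Qed.

Lemma clock_size_le : (clock_size <= L * r)%N.
Proof. by rewrite /clock_size; case: L L_gt0 => // l _ /=; nia. Qed.

Lemma leq_clock_size : (L <= clock_size)%N.
Proof. by rewrite /clock_size; case: L L_gt0 => // l _ /=; nia. Qed.

(** At [x = 1] the window sums to [L ^+ r]; Cauchy-Schwarz against the constant vector turns this
    into a lower bound on its norm. *)
Lemma window_norm2_ge : L%:R ^+ (2 * r) <= clock_size%:R * window_norm2.
Proof.
have := window_sum 1.
under eq_bigr do rewrite expr1n mulr1.
under [X in _ = X ^+ r]eq_bigr do rewrite expr1n.
rewrite sumr_const card_ord => sumE.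
have -> : L%:R ^+ (2 * r) = `|\sum_(j < clock_size) window j| ^+ 2.
  by rewrite sumE normrX normr_nat -exprM mulnC.
(* Cauchy-Schwarz, from the nonnegativity of the variance *)
set s := \sum_(j < clock_size) window j.
have N0 : 0 < clock_size%:R :> C by rewrite ltr0n.
have : 0 <= \sum_(j < clock_size) `|clock_size%:R * window j - s| ^+ 2.
  by apply: sumr_ge0 => j _; rewrite exprn_ge0.
have -> : \sum_(j < clock_size) `|clock_size%:R * window j - s| ^+ 2
   = clock_size%:R * (clock_size%:R * window_norm2 - `|s| ^+ 2).
  transitivity (\sum_(j < clock_size) (clock_size%:R ^+ 2 * `|window j| ^+ 2
     - clock_size%:R * (window j * s^* + (window j)^* * s) + `|s| ^+ 2)).
    apply: eq_bigr => j _; rewrite !normCK rmorphB rmorphM /= conjC_nat.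
    move: (window j) (clock_size%:R : C) => a b.
    move: (s^* ) (a^* ) => s' a'; ring.
  have constE : \sum_(j < clock_size) `|s| ^+ 2 = clock_size%:R * `|s| ^+ 2.
    by rewrite sumr_const card_ord [in RHS]mulr_natl.
  rewrite big_split constE sumrB -!mulr_sumr big_split -!mulr_suml -rmorph_sum.
  rewrite -/s -/window_norm2 normCK /=.
  by move: (s^* ) (clock_size%:R : C) => s' K; ring.
by rewrite pmulr_rge0 // subr_ge0.
Qed.

Lemma window_norm2_gt0 : 0 < window_norm2.
Proof.
rewrite -(pmulr_rgt0 _ (_ : 0 < clock_size%:R)) ?ltr0n //.
by apply: lt_le_trans window_norm2_ge; rewrite exprn_gt0 // ltr0n.
Qed.

(** The geometric sum times [1 - x] is [1 - x ^+ L], of modulus at most 2. A chord of at least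
    [4 / L] therefore leaves a modulus of at most [L / 2]. *)
Lemma norm_dirichlet_le (x : C) : `|x| = 1 -> 4 <= L%:R * `|1 - x| ->
  `|\sum_(i < L) x ^+ i| ^+ 2 <= L%:R ^+ 2 / 4.
Proof.
move=> x1 Lx.
have : `|\sum_(i < L) x ^+ i| * `|1 - x| <= 2.
  rewrite -normrM mulrC -opprB mulNr -subrX1 normrN.
  by apply: le_trans (ler_normB _ _) _; rewrite normrX x1 expr1n normr1.
set d := `|\sum_(i < L) x ^+ i|; set e := `|1 - x| => de.
have d0 : 0 <= d by rewrite /d.
have e0 : 0 <= e by rewrite /e.
have L0 : 0 < L%:R :> C by rewrite ltr0n.
have dL : 2 * d <= L%:R.
  have : 4 * d <= 2 * L%:R.
    apply: (@le_trans _ _ (L%:R * e * d)); first exact: ler_wpM2r.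
    by rewrite [leRHS]mulrC -mulrA ler_wpM2l ?ler0n 1?mulrC.
  by rewrite (_ : 4 = 2 * 2) -?mulrA ?ler_pM2l // -natrM.
rewrite ler_pdivlMr ?ltr0n //.
have -> : d ^+ 2 * 4 = (2 * d) ^+ 2 by rewrite exprMn mulrC -natrX.
by apply: lerXn2r => //; rewrite nnegrE ?mulr_ge0 ?ler0n.
Qed.

(** Of the [r] factors [|D m|^2], bound [r - 1] by [L^2 / 4] on the bad outcomes and sum the last
    one over all outcomes by Parseval, which gives [clock_size * L]. The lower bound on
    [window_norm2] then absorbs the powers of [L], at the cost of a factor [r] from
    [clock_size <= L * r]. *)
Lemma window_tail (w z : C) (bad : pred 'I_clock_size) :
    clock_size.-primitive_root w -> `|z| = 1 ->
    (forall m, bad m -> 4 <= L%:R * `|1 - z * w ^+ m|) ->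
  \sum_(m | bad m) `|\sum_(j < clock_size) window j * (z * w ^+ m) ^+ j| ^+ 2
    <= clock_size%:R * window_norm2 * (r%:R / 4 ^+ r.-1).
Proof.
move=> w_prim z1 far.
have N0 : (0 < clock_size)%N by [].
have w1 : `|w| = 1 := norm_root N0 w_prim.
pose D m := \sum_(i < L) (z * w ^+ m) ^+ i.
have L0 : 0 < L%:R :> C by rewrite ltr0n.
apply: (@le_trans _ _ (\sum_(m < clock_size)
   (L%:R ^+ 2 / 4) ^+ r.-1 * `|D m| ^+ 2)).
  rewrite big_mkcond; apply: ler_sum => m _.
  have K0 : 0 <= (L%:R ^+ 2 / 4 : C) by rewrite divr_ge0 ?exprn_ge0 ?ler0n.
  case: ifP => [bm|_]; last by rewrite mulr_ge0 ?exprn_ge0.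
  rewrite window_sum normrX -exprM mulnC exprM -{1}(prednK r_gt0) exprSr.
  rewrite ler_wpM2r ?exprn_ge0 // lerXn2r ?nnegrE ?exprn_ge0 //.
  by apply: norm_dirichlet_le (far _ bm); rewrite normrM normrX w1 z1 expr1n mulr1.
rewrite -mulr_sumr.
have -> : \sum_(m < clock_size) `|D m| ^+ 2 = clock_size%:R * L%:R.
  have <- : \sum_(j < L) `|z ^+ j| ^+ 2 = L%:R :> C.
    under eq_bigr do rewrite normrX z1 !expr1n.
    by rewrite sumr_const card_ord.
  rewrite -(dft_parseval N0 w_prim (fun j => z ^+ j) leq_clock_size).
  apply: eq_bigr => m _; congr (`| _ | ^+ 2); apply: eq_bigr => j _.
  by rewrite exprMn -exprM mulnC.
rewrite mulrCA -mulrA ler_wpM2l ?ler0n //.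
have rL0 : 0 < (L * r)%:R :> C by rewrite ltr0n muln_gt0 L_gt0.
rewrite mulrA expr_div_n mulrAC ler_pM2r ?invr_gt0 ?exprn_gt0 ?ltr0n //.
(* One more factor [L] makes the left side exactly the power [L ^+ (2 * r)] of [window_norm2_ge]. *)
rewrite -(ler_pM2l L0) (_ : L%:R * (_ * _) = L%:R ^+ (2 * r)); last first.
  by rewrite mulrCA -expr2 -exprM -exprD; congr (_ ^+ _); lia.
apply: le_trans window_norm2_ge _.
rewrite mulrA [leRHS]mulrAC -natrM ler_wpM2r ?ler_nat ?clock_size_le //.
exact: ltW window_norm2_gt0.
Qed.

(** Parseval again: the factors [z ^+ j] have modulus one and leave the norm of the window
    unchanged. This provides total probability 1 in the acceptance bound. *)
Lemma window_total (w z : C) :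
    clock_size.-primitive_root w -> `|z| = 1 ->
  \sum_(m < clock_size) `|\sum_(j < clock_size) window j * (z * w ^+ m) ^+ j| ^+ 2
    = clock_size%:R * window_norm2.
Proof.
move=> w_prim z1.
have -> : window_norm2 = \sum_(j < clock_size) `|window j * z ^+ j| ^+ 2.
  by apply: eq_bigr => j _; rewrite normrM normrX z1 expr1n mulr1.
rewrite -(dft_parseval (ltn0Sn _) w_prim (fun j => window j * z ^+ j)) //.
apply: eq_bigr => m _; congr (`| _ | ^+ 2); apply: eq_bigr => j _.
by rewrite exprMn -exprM mulnC mulrA.
Qed.

End ClockWindow.

(** * Hilbert-Schmidt geometry and Grover rotations *)

Section HilbertSchmidt.
Variables (C : numClosedFieldType) (m p : nat).
Local Notation T := 'M[C]_(m, p).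
Implicit Types A B : T.

Definition hs A B : C := \sum_i \sum_j (A i j)^* * B i j.

Lemma hs_linear A : scalar (hs A).
Proof.
move=> c B B'; rewrite /hs mulr_sumr -big_split; apply: eq_bigr => i _ /=.
rewrite mulr_sumr -big_split; apply: eq_bigr => j _ /=.
by rewrite !mxE mulrDr mulrCA.
Qed.

HB.instance Definition _ A := GRing.isLinear.Build C T C _ (hs A) (hs_linear A).

Lemma hsC A B : (hs A B)^* = hs B A.
Proof.
rewrite /hs rmorph_sum; apply: eq_bigr => i _; rewrite rmorph_sum.
by apply: eq_bigr => j _; rewrite rmorphM /= conjCK mulrC.
Qed.

Lemma hs_sum I (r : seq I) (P : pred I) (F : I -> T) A :
  hs A (\sum_(i <- r | P i) F i) = \sum_(i <- r | P i) hs A (F i).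
Proof. exact: linear_sum. Qed.

Lemma hsZr c A B : hs A (c *: B) = c * hs A B. Proof. exact: linearZ. Qed.
Lemma hsDr A B B' : hs A (B + B') = hs A B + hs A B'. Proof. exact: linearD. Qed.
Lemma hsBr A B B' : hs A (B - B') = hs A B - hs A B'. Proof. exact: linearB. Qed.

Lemma hsZl c A B : hs (c *: A) B = c^* * hs A B.
Proof. by rewrite -hsC hsZr rmorphM /= hsC. Qed.
Lemma hsDl A A' B : hs (A + A') B = hs A B + hs A' B.
Proof. by rewrite -hsC hsDr rmorphD /= !hsC. Qed.
Lemma hsBl A A' B : hs (A - A') B = hs A B - hs A' B.
Proof. by rewrite -hsC hsBr rmorphB /= !hsC. Qed.
Lemma hs_suml I (r : seq I) (P : pred I) (F : I -> T) A :
  hs (\sum_(i <- r | P i) F i) A = \sum_(i <- r | P i) hs (F i) A.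
Proof. by rewrite -hsC hs_sum rmorph_sum /=; apply: eq_bigr => i _; rewrite hsC. Qed.

Lemma hsE A : hs A A = \sum_i \sum_j `|A i j| ^+ 2.
Proof.
by apply: eq_bigr => i _; apply: eq_bigr => j _; rewrite normCK mulrC.
Qed.

Lemma hs_ge0 A : 0 <= hs A A.
Proof. by rewrite hsE; do 2!apply: sumr_ge0 => ? _; rewrite exprn_ge0. Qed.

Section Projection.
Variables (I : finType) (e : I -> T) (kappa : C) (S : pred I).
Hypothesis kappa_gt0 : 0 < kappa.
Hypothesis e_orth : forall P Q, hs (e P) (e Q) = if P == Q then kappa else 0.

(** The members of [e] have squared norm [kappa] rather than 1, whence the factor [kappa^-1]. The
    family is instantiated twice: by the Pauli strings, and by the identity matrix alone. *)
Definition hs_proj A : T := \sum_(P | S P) (kappa^-1 * hs (e P) A) *: e P.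
Definition hs_reflection A : T := 2 *: hs_proj A - A.

Lemma proj_linear : linear hs_proj.
Proof.
move=> c A B; rewrite /hs_proj scaler_sumr -big_split; apply: eq_bigr => P _ /=.
by rewrite hsDr hsZr mulrDr scalerDl scalerA mulrCA.
Qed.
HB.instance Definition _ := GRing.isLinear.Build C T T _ hs_proj proj_linear.

Lemma projD A B : hs_proj (A + B) = hs_proj A + hs_proj B. Proof. exact: linearD. Qed.
Lemma projB A B : hs_proj (A - B) = hs_proj A - hs_proj B. Proof. exact: linearB. Qed.
Lemma projZ c A : hs_proj (c *: A) = c *: hs_proj A. Proof. exact: linearZ. Qed.

Lemma refl_linear : linear hs_reflection.
Proof.
move=> c A B; rewrite /hs_reflection linearP scalerDr opprD addrACA.
rewrite scalerA mulrC -scalerA.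
by rewrite scalerBr.
Qed.

Lemma reflZ c A : hs_reflection (c *: A) = c *: hs_reflection A.
Proof. by rewrite /hs_reflection projZ scalerBr !scalerA mulrC. Qed.

Lemma hs_projl A B : hs (hs_proj A) B = hs A (hs_proj B).
Proof.
rewrite /hs_proj hs_suml hs_sum; apply: eq_bigr => P _.
rewrite hsZl hsZr rmorphM /= hsC mulrAC; congr (_ * _ * _).
by rewrite fmorphV /= conj_Creal // gtr0_real.
Qed.

Lemma hs_e_proj P A : S P -> hs (e P) (hs_proj A) = hs (e P) A.
Proof.
move=> SP; rewrite hs_sum (bigD1 P) //= big1 ?addr0 => [|Q /andP[_ QP]].
  by rewrite hsZr e_orth eqxx mulrAC mulVf ?mul1r // gt_eqF.
by rewrite hsZr e_orth eq_sym (negPf QP) mulr0.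
Qed.

Lemma proj_idem A : hs_proj (hs_proj A) = hs_proj A.
Proof. by apply: eq_bigr => P SP; rewrite hs_e_proj. Qed.

Lemma proj_span (alpha : I -> C) : (forall P, ~~ S P -> alpha P = 0) ->
  hs_proj (\sum_P alpha P *: e P) = \sum_P alpha P *: e P.
Proof.
move=> alpha0; rewrite [RHS](bigID S) /= [X in _ + X]big1 ?addr0; last first.
  by move=> P /alpha0 ->; rewrite scale0r.
apply: eq_bigr => P SP; congr (_ *: _).
rewrite hs_sum (bigD1 P) //= big1 ?addr0 => [|Q QP]; last first.
  by rewrite hsZr e_orth eq_sym (negPf QP) mulr0.
by rewrite hsZr e_orth eqxx mulrCA mulVf ?mulr1 // gt_eqF.
Qed.

Lemma hs_refl A B : hs (hs_reflection A) (hs_reflection B) = hs A B.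
Proof.
rewrite /hs_reflection hsBl !hsBr !hsZl !hsZr conjC_nat.
rewrite [hs (hs_proj A) (hs_proj B)]hs_projl proj_idem hs_projl.
ring.
Qed.

Lemma hs_proj_compl A : hs (hs_proj A) (A - hs_proj A) = 0.
Proof. by rewrite hsBr [hs (hs_proj A) (hs_proj A)]hs_projl proj_idem hs_projl subrr. Qed.

Lemma hs_compl A : hs (A - hs_proj A) (A - hs_proj A) = hs A A - hs (hs_proj A) (hs_proj A).
Proof.
by rewrite hsBl hs_proj_compl subr0 hsBr [hs (hs_proj A) _]hs_projl proj_idem.
Qed.

Lemma hs_compl_le A : hs (A - hs_proj A) (A - hs_proj A) <= hs A A.
Proof. by rewrite hs_compl lerBlDr lerDl hs_ge0. Qed.

(** * The Grover rotation in the plane of the two components of [U] *)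

Section Grover.
Variables (U : T) (a b : C).
Hypothesis U_norm : hs U U = kappa.
Hypothesis a_real : a \is Num.real.
Hypothesis b_real : b \is Num.real.
Hypothesis ab1 : a ^+ 2 + b ^+ 2 = 1.
Hypothesis a_norm : hs (U - hs_proj U) (U - hs_proj U) = kappa * a ^+ 2.

(** The reflection through the span of the selected [e P], followed by the reflection through the
    line of [U]; the factor [kappa^-1] fits because [hs U U = kappa]. *)
Definition grover A : T :=
  (2 * (kappa^-1 * hs U (hs_reflection A))) *: U - hs_reflection A.

(** Coordinates along [hs_proj U] and [U - hs_proj U]. Leaving these two vectors unnormalised avoids
    dividing by [a] or [b], either of which may vanish. The local [s] is the overlap of [U] with the
    reflected iterate, divided by [kappa]. *)
Fixpoint grover_coef (j : nat) : C * C :=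
  if j is j'.+1 then
    let: (q, p') := grover_coef j' in
    let s := b ^+ 2 * q - a ^+ 2 * p' in (2 * s - q, 2 * s + p')
  else (1, 1).

Lemma hs_proj_norm : hs (hs_proj U) (hs_proj U) = kappa * b ^+ 2.
Proof.
have := hs_compl U; rewrite a_norm U_norm => /eqP.
rewrite eq_sym subr_eq addrC -subr_eq => /eqP <-.
by rewrite -[X in X - _]mulr1 -ab1 mulrDr addrAC subrr add0r.
Qed.

(** The first reflection only flips the sign of the component along [U - hs_proj U], and the second
    adds a multiple of [U], so the plane of the two components is invariant. *)
Lemma iter_grover j : iter j grover U =
  (grover_coef j).1 *: hs_proj U + (grover_coef j).2 *: (U - hs_proj U).
Proof.
elim: j => [|j IHj] /=; first by rewrite !scale1r addrC subrK.
rewrite IHj; case: (grover_coef j) => q p' /=.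
set V := U - hs_proj U.
have reflE : hs_reflection (q *: hs_proj U + p' *: V) = q *: hs_proj U - p' *: V.
  have projE : hs_proj (q *: hs_proj U + p' *: V) = q *: hs_proj U.
    rewrite projD !projZ projB proj_idem subrr.
    by rewrite scaler0 addr0.
  by rewrite /hs_reflection projE scaler_nat mulr2n opprD addrACA subrr add0r.
have k0 : kappa != 0 by rewrite gt_eqF.
have UV : U = hs_proj U + V by rewrite /V addrC subrK.
have hsU : hs U (q *: hs_proj U - p' *: V) = kappa * (b ^+ 2 * q - a ^+ 2 * p').
  rewrite hsBr !hsZr -{1}proj_idem -hs_projl hs_proj_norm {1}UV hsDl a_norm.
  by rewrite hs_proj_compl add0r; ring.
rewrite /grover reflE hsU mulKf //; set s := b ^+ 2 * q - a ^+ 2 * p'.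
by rewrite {1}UV scalerDr opprB [p' *: V - _]addrC addrACA -scalerBl -scalerDl.
Qed.

(* With [(b, a) = (cos t, sin t)] this says that the components of the [j]-th
   iterate are [cos ((2j+1)t)] and [sin ((2j+1)t)]; [iota] ranges over [+i], [-i]. *)
Lemma grover_coefE (iota : C) j : iota ^+ 2 = -1 ->
  b * (grover_coef j).1 + iota * (a * (grover_coef j).2)
  = (b + iota * a) * ((b + iota * a) ^+ 2) ^+ j.
Proof.
move=> iota2; have a2 : a ^+ 2 = 1 - b ^+ 2 by rewrite -ab1 addrK.
elim: j => [|j IHj]; first by rewrite /= expr0 !mulr1.
rewrite [_ ^+ j.+1]exprSr [RHS]mulrA -IHj /=; case: (grover_coef j) => q p' /=.
have -> : (b + iota * a) ^+ 2 = 2 * b ^+ 2 - 1 + 2 * iota * (a * b).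
  by rewrite sqrrD exprMn iota2 a2; ring.
have -> : a * (2 * (b ^+ 2 * q - a ^+ 2 * p') + p')
   = 2 * b ^+ 2 * (a * q) + (1 - 2 * a ^+ 2) * (a * p') by ring.
have -> : 1 - 2 * a ^+ 2 = 2 * b ^+ 2 - 1 by rewrite a2; ring.
transitivity (b * q * (2 * b ^+ 2 - 1) + 2 * iota * a * b * b * q
  + (iota * a * p' * (2 * b ^+ 2 - 1) + 2 * iota ^+ 2 * a ^+ 2 * b * p')); last by ring.
by rewrite iota2; ring.
Qed.

(** [U] has half of its squared norm on each of the eigenvalues [z] and [z^*] of the rotation.
    Concretely, the two terms on the right are [|b q + i a p'|^2] and [|b q - i a p'|^2], whose
    cross terms cancel in the sum. *)
Lemma grover_sum_norm N (f : nat -> C) (z := (b + 'i * a) ^+ 2) :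
  let X := \sum_(j < N) f j *: iter j grover U in
  hs X X = kappa / 2 *
    (`|\sum_(j < N) f j * z ^+ j| ^+ 2 + `|\sum_(j < N) f j * z^* ^+ j| ^+ 2).
Proof.
move=> X.
pose q := \sum_(j < N) f j * (grover_coef j).1.
pose p' := \sum_(j < N) f j * (grover_coef j).2.
have XE : X = q *: hs_proj U + p' *: (U - hs_proj U).
  rewrite /X /q /p' !scaler_suml -big_split; apply: eq_bigr => j _ /=.
  by rewrite iter_grover scalerDr !scalerA.
have sumE iota : iota ^+ 2 = -1 ->
   b * q + iota * (a * p') =
     (b + iota * a) * \sum_(j < N) f j * ((b + iota * a) ^+ 2) ^+ j.
  move=> iota2; rewrite /q /p' !mulr_sumr -big_split; apply: eq_bigr => j _ /=.
  by rewrite [RHS]mulrCA -grover_coefE //; ring.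
have normu iota : iota ^* = - iota -> iota ^+ 2 = -1 -> `|b + iota * a| = 1.
  move=> iC i2; apply/eqP; rewrite -(@pexpr_eq1 _ _ 2) // normCK rmorphD rmorphM /=.
  rewrite (conj_Creal a_real) (conj_Creal b_real) iC.
  have -> : (b + iota * a) * (b + - iota * a) = b ^+ 2 - iota ^+ 2 * a ^+ 2 by ring.
  by rewrite i2 mulN1r opprK addrC ab1.
have ii : 'i ^+ 2 = -1 :> C by exact: sqrCi.
have iN : (- 'i) ^+ 2 = -1 :> C by rewrite sqrrN.
have ic : 'i^* = - 'i :> C by exact: conjCi.
have iNc : (- 'i)^* = - (- 'i) :> C by rewrite rmorphN /= ic.
have zc : z^* = (b + - 'i * a) ^+ 2.
  rewrite /z rmorphXn rmorphD rmorphM /=.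
  by rewrite (conj_Creal a_real) (conj_Creal b_real) ic.
have norms iota : iota ^* = - iota -> iota ^+ 2 = -1 ->
   `|\sum_(j < N) f j * ((b + iota * a) ^+ 2) ^+ j| ^+ 2 = `|b * q + iota * (a * p')| ^+ 2.
  by move=> iC i2; rewrite sumE // normrM normu // mul1r.
rewrite zc (norms _ ic ii) (norms _ iNc iN) XE.
move: (hs_proj_compl U) a_norm; move: (U - hs_proj U) => V PV VV.
have VP : hs V (hs_proj U) = 0 by rewrite -hsC PV conjC0.
rewrite hsDl !hsDr !hsZl !hsZr PV VP VV hs_proj_norm !mulr0 addr0 add0r.
rewrite !normCK !rmorphD !rmorphM /= (conj_Creal a_real) (conj_Creal b_real) iNc ic.
move: (p'^* ) (q^* ) => pc qc.
transitivity (kappa / 2 * (2 * b ^+ 2 * (q * qc) - 2 * 'i ^+ 2 * a ^+ 2 * (p' * pc))).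
  by rewrite ii; field.
by congr (_ * _); ring.
Qed.

End Grover.
End Projection.
End HilbertSchmidt.

(** * Block encoding of the circuit *)

Section Circuit.
Variable R : realType.
Local Notation C := R[i].

Lemma conjcE (z : C) : conjc z = z^*. Proof. by []. Qed.

Lemma abs2E (z : C) : ((abs2 z)%:C)%C = `|z| ^+ 2.
Proof. exact: add_Re2_Im2. Qed.

Lemma adjmxE m p (A : 'M[C]_(m, p)) i j : adjmx A i j = (A j i)^*.
Proof. by rewrite !mxE. Qed.

Lemma hs_trace m p (A B : 'M[C]_(m, p)) : hs A B = \tr (adjmx A *m B).
Proof.
rewrite /hs /mxtrace exchange_big; apply: eq_bigr => j _ /=.
by rewrite mxE; apply: eq_bigr => i _; rewrite adjmxE.
Qed.

Lemma adjmxM m p q (A : 'M[C]_(m, p)) (B : 'M[C]_(p, q)) :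
  adjmx (A *m B) = adjmx B *m adjmx A.
Proof. by rewrite /adjmx trmx_mul map_mxM. Qed.

Lemma hs_mull m p q (U : 'M[C]_(m, p)) (A : 'M[C]_(p, q)) B :
  hs (U *m A) B = hs A (adjmx U *m B).
Proof. by rewrite !hs_trace adjmxM mulmxA. Qed.

Lemma hs1 m : hs (1%:M : 'M[C]_m) 1%:M = m%:R.
Proof.
rewrite hs_trace mulmx1 -[RHS](mxtrace1 C); congr (\tr _).
by apply/matrixP => i j; rewrite adjmxE !mxE eq_sym conjC_nat.
Qed.

Lemma sum_mxvec (V : nmodType) m p (F : C -> C -> V) (A B : 'M[C]_(m, p)) :
  \sum_o F (mxvec A 0 o) (mxvec B 0 o) = \sum_i \sum_j F (A i j) (B i j).
Proof.
rewrite (reindex _ (curry_mxvec_bij _ _)) /= pair_big /=.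
by apply: eq_bigr => -[i j] _; rewrite !mxvecE.
Qed.

Section Isometry.
Variables (m p : nat) (g : 'M[C]_(m, p) -> 'M[C]_(m, p)).
Hypothesis g_linear : linear g.

Lemma mul_mxvec_lin_mx A : mxvec A *m lin_mx g = mxvec (g A).
Proof.
pose gL : {linear 'M[C]_(m, p) -> 'M[C]_(m, p)} :=
  HB.pack g (GRing.isLinear.Build C _ _ _ g g_linear).
exact: (mul_vec_lin gL).
Qed.

Hypothesis g_isometry : forall A B, hs (g A) (g B) = hs A B.

(** The rows of [lin_mx g] are the images of the matrix units, and an isometry keeps these
    orthonormal. Vectors are rows multiplied on the right, as in [apply_unitary]. *)
Lemma isometry_unitary : Defs.is_unitary (lin_mx g).
Proof.
have rowE k : row k (lin_mx g) = mxvec (g (vec_mx (delta_mx 0 k))).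
  by rewrite -mul_mxvec_lin_mx vec_mxK -rowE.
apply/matrixP => k l; rewrite mxE.
transitivity (hs (g (vec_mx (delta_mx 0 l))) (g (vec_mx (delta_mx 0 k)))).
  rewrite /hs -(sum_mxvec (fun x y => x^* * y)) -!rowE.
  by apply: eq_bigr => o _; rewrite adjmxE !mxE mulrC.
rewrite g_isometry /hs -(sum_mxvec (fun x y => x^* * y)) !vec_mxK (bigD1 l) //=.
rewrite big1 ?addr0 => [|o ol]; last by rewrite !mxE (negPf ol) conjC0 mul0r.
by rewrite !mxE !eqxx conjC1 mul1r eq_sym.
Qed.

End Isometry.

Section Blocks.
Variables n N : nat.
Local Notation D := (2 ^ n)%N.
Local Notation d := (#|{: 'I_N * 'I_D}|).
Local Notation state := 'M[C]_(D, d).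

(* The ancilla is a clock of dimension N together with a copy of the system, so a
   joint state is a family of N blocks, each of them a D x D matrix. *)
Definition block (psi : state) (j : 'I_N) : 'M[C]_D :=
  \matrix_(i, s) psi i (enum_rank (j, s)).

Definition unblock (F : 'I_N -> 'M[C]_D) : state :=
  \matrix_(i, a) F (enum_val a).1 i (enum_val a).2.

Lemma unblockK F j : block (unblock F) j = F j.
Proof. by apply/matrixP => i s; rewrite !mxE enum_rankK. Qed.

Lemma block_linear j : linear (block^~ j).
Proof. by move=> c A B; apply/matrixP => i s; rewrite !mxE. Qed.

Lemma block_mul (U : 'M[C]_D) psi j : block (U *m psi) j = U *m block psi j.
Proof.
by apply/matrixP => i s; rewrite !mxE; apply: eq_bigr => k _; rewrite !mxE.
Qed.

Lemma sum_blocks (V : nmodType) (F : 'I_D -> 'I_N -> 'I_D -> V) :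
  \sum_i \sum_(a < d) F i (enum_val a).1 (enum_val a).2
  = \sum_j \sum_i \sum_s F i j s.
Proof.
rewrite [RHS]exchange_big; apply: eq_bigr => i _ /=.
rewrite pair_big /= (reindex (fun a : 'I_d => enum_val a)) //=.
by exists enum_rank => x _; rewrite ?enum_valK ?enum_rankK.
Qed.

Lemma hs_blocks (psi phi : state) :
  hs psi phi = \sum_j hs (block psi j) (block phi j).
Proof.
rewrite /hs -(sum_blocks (fun i j s => (block psi j i s)^* * block phi j i s)).
apply: eq_bigr => i _; apply: eq_bigr => a _.
by rewrite !mxE -surjective_pairing enum_valK.
Qed.

Section Controlled.
Variables (i : nat) (f : 'M[C]_D -> 'M[C]_D).

(** With the threshold [i < j], block [j] takes part in rounds [0] to [j - 1] only, hence in exactly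
    [j] Grover iterations. *)
Definition controlled (psi : state) : state :=
  unblock (fun j => if (i < j)%N then f (block psi j) else block psi j).

Hypothesis f_linear : linear f.
Hypothesis f_isometry : forall A B, hs (f A) (f B) = hs A B.

Lemma controlled_linear : linear controlled.
Proof.
move=> c A B; apply/matrixP => k a.
rewrite [LHS]mxE block_linear [RHS]mxE [X in _ = X + _]mxE !mxE.
case: ifP => _; first by rewrite f_linear !mxE.
by rewrite !mxE.
Qed.

Lemma controlled_isometry A B : hs (controlled A) (controlled B) = hs A B.
Proof.
rewrite !hs_blocks; apply: eq_bigr => j _; rewrite !unblockK.
by case: ifP => // _; rewrite f_isometry.
Qed.

End Controlled.

Section Fourier.
Variable w : C.

Definition fourier (psi : state) : state :=
  unblock (fun m => (sqrtC N%:R)^-1 *: \sum_(j < N) w ^+ (j * m) *: block psi j).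

Lemma fourier_linear : linear fourier.
Proof.
move=> c A B.
have E j : block (fourier (c *: A + B)) j
         = c *: block (fourier A) j + block (fourier B) j.
  rewrite !unblockK scalerA [c * _]mulrC -scalerA -scalerDr; congr (_ *: _).
  rewrite scaler_sumr -big_split; apply: eq_bigr => k _ /=.
  by rewrite block_linear scalerDr !scalerA [c * _]mulrC.
apply/matrixP => i a; have /matrixP/(_ i (enum_val a).2) := E (enum_val a).1.
by rewrite !mxE -!surjective_pairing enum_valK.
Qed.

Hypothesis N_gt0 : (0 < N)%N.
Hypothesis w_prim : N.-primitive_root w.

(** Expanding both transforms leaves character sums that vanish off the diagonal; the two real
    prefactors multiply to [1 / N] and cancel the diagonal value [N]. *)
Lemma fourier_isometry A B : hs (fourier A) (fourier B) = hs A B.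
Proof.
have N0 : N%:R != 0 :> C by rewrite pnatr_eq0 -lt0n.
rewrite !hs_blocks; under eq_bigr do rewrite !unblockK hsZl hsZr.
rewrite -mulr_sumr -mulr_sumr mulrA.
have -> : (sqrtC N%:R)^-1^* * (sqrtC N%:R)^-1 = N%:R^-1 :> C.
  rewrite fmorphV /= conj_Creal ?ger0_real ?sqrtC_ge0 ?ler0n // -invfM.
  by rewrite -expr2 sqrtCK.
apply: (mulfI N0); rewrite mulrA mulfV // mul1r mulr_sumr.
transitivity (\sum_(k < N) \sum_(l < N) hs (block A k) (block B l) *
   \sum_(m < N) w ^+ (l * m) * (w ^+ (k * m))^*).
  under eq_bigr => m _ do rewrite hs_suml.
  rewrite exchange_big; apply: eq_bigr => k _ /=.
  under eq_bigr => m _ do rewrite hs_sum.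
  rewrite exchange_big; apply: eq_bigr => l _ /=; rewrite mulr_sumr.
  apply: eq_bigr => m _; rewrite hsZl hsZr mulrC mulrCA mulrA mulrC.
  by congr (_ * _); rewrite mulrC.
apply: eq_bigr => k _; rewrite (bigD1 k) //= dft_orthogonality // eqxx.
rewrite big1 ?addr0 => [|l lk]; first by rewrite mulrC.
by rewrite dft_orthogonality // (inj_eq val_inj) (negPf lk) mulr0.
Qed.

End Fourier.

Definition clock_outcomes (S : pred 'I_N) : {set 'I_(D * d)} :=
  [set mxvec_index x.1 x.2 | x in [set x : 'I_D * 'I_d | S (enum_val x.2).1]].

Lemma clock_outcomes_prob (S : pred 'I_N) (psi : state) :
  ((\sum_(o in clock_outcomes S) abs2 (mxvec psi 0 o))%:C)%C
  = \sum_(m | S m) hs (block psi m) (block psi m).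
Proof.
rewrite rmorph_sum big_imset /=; last first.
  by move=> [x1 x2] [y1 y2] _ _ /cast_ord_inj /enum_rank_inj.
pose F i j s : C := if S j then `|block psi j i s| ^+ 2 else 0.
transitivity (\sum_i \sum_(a < d) F i (enum_val a).1 (enum_val a).2).
  rewrite /F.
  rewrite pair_big /= [RHS](bigID (fun x : 'I_D * 'I_d => S (enum_val x.2).1)) /=.
  rewrite [X in _ = _ + X]big1 ?addr0 => [|x /negPf-> //].
  apply: eq_big => [x|x]; first by rewrite inE.
  rewrite inE => Sx; rewrite Sx mxvecE !mxE -surjective_pairing enum_valK.
  exact: abs2E.
rewrite sum_blocks [RHS]big_mkcond; apply: eq_bigr => j _; rewrite /F.
case: ifP => Sj; first by rewrite hsE.
by rewrite big1 // => i _; rewrite big1.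
Qed.

End Blocks.
End Circuit.

(** * The circuit: coherent phase estimation of the Grover rotation *)

Section ClockAlgorithm.
Variable R : realType.
Local Notation C := R[i].
Variables (n : nat) (I : finType) (e : I -> 'M[C]_(2 ^ n)) (S : pred I).
Local Notation D := (2 ^ n)%N.
Local Notation kappa := (D%:R : C).
Hypothesis e_orth : forall P Q, hs (e P) (e Q) = if P == Q then kappa else 0.

Lemma adjmx1 m : adjmx (1%:M : 'M[C]_m) = 1%:M.
Proof. by apply/matrixP => i j; rewrite adjmxE !mxE eq_sym conjC_nat. Qed.

Lemma dim_gt0 : 0 < kappa.
Proof. by rewrite ltr0n expn_gt0. Qed.

(** As a matrix, the maximally entangled state of the system and its copy is a multiple of the
    identity; this one-element family yields the reflection through it. *)
Definition id_family (_ : unit) : 'M[C]_D := 1%:M.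

Lemma id_family_orth P Q :
  hs (id_family P) (id_family Q) = if P == Q then kappa else 0.
Proof. by rewrite hs1; case: P Q => [] []. Qed.

Local Notation refl_S := (hs_reflection e kappa S).
Local Notation refl_id := (hs_reflection id_family kappa predT).

Lemma groverZ U c A :
  grover e kappa S U (c *: A) = c *: grover e kappa S U A.
Proof.
rewrite /grover reflZ hsZr [RHS]scalerBr [in RHS]scalerA; congr (_ *: _ - _).
by rewrite !mulrA; congr (_ * _); rewrite mulrC mulrA.
Qed.

(** Conjugating the reflection through the identity by [U] gives the reflection through [U], since
    [hs 1 (adjmx U *m B) = hs U B]. So one inverse query and one forward query implement a Grover
    step, and both reflections are independent of [H]. *)
Lemma grover_two_reflections U A : U *m adjmx U = 1%:M ->
  U *m refl_id (adjmx U *m refl_S A) = grover e kappa S U A.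
Proof.
move=> UU; rewrite /grover {1}/hs_reflection /hs_proj (bigD1 tt) //= big1 ?addr0 => [|[] //].
rewrite mulmxBr mulmxA UU mul1mx -!scalemxAr mulmx1 scalerA.
by rewrite -hs_mull mulmx1.
Qed.

Variables (L r : nat) (w : C) (t : R) (acc : pred 'I_(clock_size L r)).
Local Notation N := (clock_size L r).
Local Notation d := (#|{: 'I_N * 'I_D}|).
Local Notation W := (window_norm2 C L r).
Local Notation c j := (window C L r j / sqrtC (kappa * W)).

(** Only the reflections are controlled by the clock. On blocks where they are switched off, the
    uncontrolled inverse and forward queries cancel. *)
Definition grover_round (i : nat) : seq ('M[C]_(D * d) * query R d) :=
  [:: (lin_mx (@controlled R n N i refl_S), Query t true None);
      (lin_mx (@controlled R n N i refl_id), Query t false None)].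

(** The initial state is the window on the clock times a maximally entangled pair, so the first
    query puts a multiple of [U] in every block. Since the clock values end at [N.-1], that many
    rounds suffice. *)
Definition clock_algorithm : algorithm R n :=
  @Algorithm R n d
    (unblock (fun j : 'I_N => c j *: 1%:M))
    ((1%:M, Query t false None) :: flatten [seq grover_round i | i <- iota 0 N.-1])
    (lin_mx (@fourier R n N w))
    (@clock_outcomes n N acc).

Lemma size_grover_rounds s : size (flatten [seq grover_round i | i <- s]) = (size s).*2.
Proof. by elim: s => //= i s ->. Qed.

Lemma clock_num_queries : num_queries clock_algorithm = (L.-1 * r).*2.+1.
Proof. by rewrite /num_queries /= size_grover_rounds size_iota. Qed.

Lemma clock_total_time : total_time clock_algorithm = t * (L.-1 * r).*2.+1%:R.
Proof.
rewrite -clock_num_queries /total_time /num_queries.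
have : all (fun s => q_time s.2 == t) (steps clock_algorithm).
  by rewrite /= eqxx /=; elim: (iota _ _) => //= i s ->; rewrite !eqxx.
elim: (steps _) => [|s ss IH] /=; first by rewrite big_nil mulr0.
move=> /andP[/eqP st /IH{}IH].
by rewrite big_cons IH st -[in RHS]addn1 natrD mulrDr mulr1 addrC.
Qed.

Hypothesis L_gt0 : (0 < L)%N.
Hypothesis r_gt0 : (0 < r)%N.
Hypothesis w_prim : N.-primitive_root w.

Lemma sqr_norm_coef x : `|x / sqrtC (kappa * W)| ^+ 2 = `|x| ^+ 2 / (kappa * W).
Proof.
have kW : 0 <= kappa * W.
  by rewrite mulr_ge0 ?ltW ?dim_gt0 //; exact: window_norm2_gt0.
by rewrite normrM exprMn normfV exprVn [`|sqrtC _|]ger0_norm ?sqrtC_ge0 // sqrtCK.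
Qed.

Lemma clock_algorithm_valid : 0 <= t -> valid_algorithm clock_algorithm.
Proof.
move=> t0; split; [|split].
- apply: (@complexI R); rewrite rmorph_sum /=.
  transitivity (hs (init clock_algorithm) (init clock_algorithm)).
    rewrite hsE; apply: eq_bigr => i _; rewrite rmorph_sum; apply: eq_bigr => j _.
    exact: abs2E.
  rewrite hs_blocks.
  have W0 : W != 0 by rewrite gt_eqF //; exact: window_norm2_gt0.
  have k0 : kappa != 0 by rewrite gt_eqF // dim_gt0.
  transitivity (\sum_(j < N) `|window C L r j| ^+ 2 / W).
    apply: eq_bigr => j _.
    rewrite unblockK hsZl hsZr mulrA [_^* * _]mulrC -normCK sqr_norm_coef hs1.
    by rewrite invfM [_^-1 * _]mulrC mulrA mulfVK.
  by rewrite -mulr_suml mulfV.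
- apply: isometry_unitary; first exact: fourier_linear.
  exact: (fourier_isometry (ltn0Sn _) w_prim).
- rewrite /=; split; first by rewrite /Defs.is_unitary adjmx1 mulmx1.
  elim: (iota _ _) => //= i s IH; do !split=> //=; apply: isometry_unitary.
  + exact/controlled_linear/refl_linear.
  + by apply: controlled_isometry => A B; exact: (hs_refl _ dim_gt0 e_orth).
  + exact/controlled_linear/refl_linear.
  + by apply: controlled_isometry => A B; exact: (hs_refl _ dim_gt0 id_family_orth).
Qed.

Section Run.
Variables (H : 'M[C]_D).
Local Notation U := (evol H t).
Hypothesis U_unitary : U *m adjmx U = 1%:M.
Hypothesis U_inverse : evol_inv H t = adjmx U.

Lemma block_run (j : 'I_N) :
  block (run clock_algorithm H) j = c j *: iter j (grover e kappa S U) U.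
Proof.
pose step (psi : 'M[C]_(D, d)) s := apply_query H s.2 (apply_unitary s.1 psi).
(* Induction on the number [M] of rounds: block [j] is iterated until [M] reaches [j] and stays
   fixed from then on, hence the exponent [minn j M]. *)
have loop M : block (foldl step (init clock_algorithm)
    ((1%:M, Query t false None) :: flatten [seq grover_round i | i <- iota 0 M])) j
  = c j *: iter (minn j M) (grover e kappa S U) U.
  elim: M => [|M IH].
    rewrite minn0 /= /step /apply_query /= /apply_unitary mulmx1 mxvecK block_mul.
    by rewrite unblockK -scalemxAr mulmx1.
  rewrite -(addn1 M) iotaD map_cat flatten_cat -cat_cons foldl_cat.
  set psi := foldl _ _ (_ :: _) in IH *.
  rewrite /= /step /apply_query /apply_unitary /= U_inverse.
  rewrite !mul_mxvec_lin_mx; try exact/controlled_linear/refl_linear.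
  rewrite !mxvecK block_mul unblockK block_mul unblockK IH.
  rewrite add0n addn1; case: ltnP => Mj.
    by rewrite grover_two_reflections // groverZ (minn_idPr Mj).
  by rewrite mulmxA U_unitary mul1mx (minn_idPl _) // ltnW.
have -> : run clock_algorithm H = foldl step (init clock_algorithm)
    ((1%:M, Query t false None) :: flatten [seq grover_round i | i <- iota 0 N.-1]).
  by [].
by rewrite loop (minn_idPl _) // -ltnS.
Qed.

Variable a : R.
Hypothesis a_ge0 : 0 <= a.
Hypothesis a_norm : hs (U - hs_proj e kappa S U) (U - hs_proj e kappa S U)
  = kappa * (a%:C)%C ^+ 2.

Local Notation ac := ((a%:C)%C : C).

Lemma hsU : hs U U = kappa.
Proof.
rewrite hs_trace (mulmx1C U_unitary) -(mxtrace1 C).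
by [].
Qed.

Let b := sqrtC (1 - ac ^+ 2).
Let z := (b + 'i * ac) ^+ 2.

(** A projection does not increase the norm, so [a] is at most 1; this makes the cosine [b] real. *)
Lemma amplitude_le1 : 0 <= 1 - ac ^+ 2.
Proof.
rewrite subr_ge0 -(ler_pM2l dim_gt0) mulr1 -a_norm -[leRHS]hsU.
exact: (hs_compl_le _ dim_gt0 e_orth).
Qed.

Lemma amplitude_ge0 : 0 <= ac. Proof. by rewrite ler0c. Qed.

Lemma ab_sqr : ac ^+ 2 + b ^+ 2 = 1.
Proof. by rewrite sqrtCK addrC subrK. Qed.

Lemma b_real : b \is Num.real.
Proof. by rewrite ger0_real // sqrtC_ge0 amplitude_le1. Qed.

(** With [u = b + i a] on the unit circle, [1 - z = u (u^* - u) = - 2 i a u]. The chord of the phase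
    is thus linear in the amplitude, and no angle has to be computed. *)
Lemma phase_norm : `|z| = 1 /\ `|1 - z| = 2 * ac.
Proof.
have ac_real : ac \is Num.real by rewrite ger0_real ?amplitude_ge0.
have ii : 'i ^+ 2 = -1 :> C by exact: sqrCi.
set u := b + 'i * ac.
have uu : u * (b - 'i * ac) = 1.
  by rewrite mulrC -subr_sqr exprMn ii mulN1r opprK addrC ab_sqr.
have u1 : `|u| = 1.
  apply/eqP; rewrite -(@pexpr_eq1 _ _ 2) // normCK rmorphD rmorphM /=.
  by rewrite (conj_Creal ac_real) (conj_Creal b_real) conjCi mulNr uu.
rewrite normrX u1 expr1n; split=> //.
have -> : 1 - z = u * (- (2 * ('i * ac))).
  by rewrite -[X in X - _ = _]uu /z /u; move: b ('i * ac) => x y; ring.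
by rewrite normrM u1 mul1r normrN !normrM normCi mul1r normr_nat ger0_norm ?amplitude_ge0.
Qed.

(** The prefactor collects [1 / N] from the Fourier transform, [1 / (kappa W)] from the initial
    amplitudes and [kappa / 2] from [grover_sum_norm]. *)
Lemma clock_accept_probE :
  ((accept_prob clock_algorithm H)%:C)%C
  = (2 * (N%:R * W))^-1 * \sum_(m | acc m)
      (`|\sum_(j < N) window C L r j * (z * w ^+ m) ^+ j| ^+ 2
     + `|\sum_(j < N) window C L r j * (z^* * w ^+ m) ^+ j| ^+ 2).
Proof.
have W0 : W != 0 by rewrite gt_eqF //; exact: window_norm2_gt0.
have k0 : kappa != 0 by rewrite gt_eqF // dim_gt0.
have N0 : N%:R != 0 :> C by rewrite pnatr_eq0.
rewrite /accept_prob mul_mxvec_lin_mx; last exact: fourier_linear.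
rewrite clock_outcomes_prob mulr_sumr; apply: eq_bigr => m _.
have -> : block (fourier w (run clock_algorithm H)) m
  = (sqrtC N%:R)^-1 *: ((1 / sqrtC (kappa * W)) *: \sum_(j < N)
     (window C L r j * w ^+ (j * m)) *: iter j (grover e kappa S U) U).
  rewrite unblockK; congr (_ *: _); rewrite scaler_sumr; apply: eq_bigr => j _.
  by rewrite block_run !scalerA; congr (_ *: _); ring.
rewrite hsZl hsZr mulrA [_^* * _]mulrC -normCK normfV exprVn.
rewrite ger0_norm ?sqrtC_ge0 ?ler0n // sqrtCK.
rewrite hsZl hsZr [X in _ * X]mulrA [_^* * _]mulrC -normCK sqr_norm_coef normr1 expr1n.
have ac_real : ac \is Num.real by rewrite ger0_real ?amplitude_ge0.
rewrite (grover_sum_norm dim_gt0 e_orth hsU ac_real b_real ab_sqr a_norm N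
  (fun j => window C L r j * w ^+ (j * m))) -/z.
have sumE x : \sum_(j < N) window C L r j * w ^+ (j * m) * x ^+ j
  = \sum_(j < N) window C L r j * (x * w ^+ m) ^+ j.
  by apply: eq_bigr => j _; rewrite exprMn -exprM [(j * m)%N]mulnC mulrAC mulrA.
rewrite !sumE; move: (_ + _) => Y; field.
by rewrite N0 k0 W0.
Qed.

End Run.
End ClockAlgorithm.

(** * Separating two amplitudes by a threshold on the clock outcome *)

Section ThresholdTest.
Variable R : realType.
Local Notation C := R[i].
Variables (n : nat) (I : finType) (e : I -> 'M[C]_(2 ^ n)) (S : pred I).
Local Notation D := (2 ^ n)%N.
Hypothesis e_orth :
  forall P Q, hs (e P) (e Q) = if P == Q then D%:R : C else 0.
Variables (L r : nat) (w : C) (t a1 a2 : R).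
Hypothesis L_gt0 : (0 < L)%N.
Hypothesis r_gt0 : (0 < r)%N.
Local Notation N := (clock_size L r).
Local Notation W := (window_norm2 C L r).
Hypothesis w_prim : N.-primitive_root w.
Hypothesis gap : 4 <= L%:R * (a2 - a1).

(* The phase [z] of the Grover rotation has chord [`|1 - z| = 2 a], so the clock
   outcome [m] is accepted when the chord of [w ^+ m] is at most [a1 + a2]. *)
Definition below_threshold : pred 'I_N :=
  fun m => `|1 - w ^+ m| <= ((a1 + a2)%:C)%C.

Definition threshold_test := clock_algorithm e S w t below_threshold.

Variable (H : 'M[C]_D).
Local Notation U := (evol H t).
Hypothesis U_unitary : U *m adjmx U = 1%:M.
Hypothesis U_inverse : evol_inv H t = adjmx U.
Variable a : R.
Hypothesis a_ge0 : 0 <= a.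
Local Notation V := (U - hs_proj e (D%:R : C) S U).
Hypothesis a_norm : hs V V = D%:R * (a%:C)%C ^+ 2.

(** Multiplying by [w ^+ m] preserves distances, so the chord of [z * w ^+ m] is at least the
    difference of the chords of [w ^+ m] and [z]. As [z] and [z^*] have equal chords, the same bad
    set serves both, and the result is an average of two window tails. *)
Lemma double_window_tail (z : C) (bad : pred 'I_N) :
    `|z| = 1 ->
    (forall m, bad m -> 4 <= L%:R * `| `|1 - w ^+ m| - `|1 - z| |) ->
  (2 * (N%:R * W))^-1 * \sum_(m | bad m)
      (`|\sum_(j < N) window C L r j * (z * w ^+ m) ^+ j| ^+ 2
     + `|\sum_(j < N) window C L r j * (z^* * w ^+ m) ^+ j| ^+ 2)
  <= r%:R / 4 ^+ r.-1.
Proof.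
move=> z1 far.
have W0 : 0 < W := window_norm2_gt0 C r L_gt0.
have N0 : 0 < N%:R :> C by rewrite ltr0n.
have w1 : `|w| = 1 := norm_root (ltn0Sn _) w_prim.
have zc1 : `|z^*| = 1 by rewrite norm_conjC.
have chord y m : `|y| = 1 -> `|1 - y| = `|1 - z| -> bad m ->
    4 <= L%:R * `|1 - y * w ^+ m|.
  move=> y1 yz /far/le_trans; apply; rewrite ler_wpM2l ?ler0n // -yz.
  have -> : `|1 - y| = `|y * w ^+ m - w ^+ m|.
    have -> : y * w ^+ m - w ^+ m = (y - 1) * w ^+ m by rewrite mulrBl mul1r.
    by rewrite normrM normrX w1 expr1n mulr1 distrC.
  apply: le_trans (ler_dist_dist _ _) _.
  by rewrite opprB addrA addrNK.
rewrite ler_pdivrMl ?mulr_gt0 // big_split /= -[leRHS]mulrA [leRHS]mulr_natl mulr2n.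
have czz : `|1 - z^*| = `|1 - z| by rewrite -[in LHS](conjC1 C) -rmorphB norm_conjC.
by apply: lerD; apply: window_tail => // m bm; exact: chord.
Qed.

(** The rejection probability is bounded and subtracted from the total probability 1. A rejected
    outcome has chord above [a1 + a2], whereas the phase has chord [2 a <= 2 a1]; they differ by at
    least [a2 - a1], which [gap] compares with [4 / L]. *)
Lemma threshold_test_accepts : a <= a1 ->
  1 - r%:R / 4 ^+ r.-1 <= accept_prob threshold_test H.
Proof.
move=> aa1; rewrite -lecR (clock_accept_probE e_orth w below_threshold L_gt0
  U_unitary U_inverse a_ge0 a_norm).
have [] := phase_norm e_orth U_unitary a_ge0 a_norm.
set z := (_ + _) ^+ 2 => z1 chord_z.
have W0 : 0 < W := window_norm2_gt0 C r L_gt0.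
have N0 : 0 < N%:R :> C by rewrite ltr0n.
have tail := @double_window_tail z (predC below_threshold) z1 _.
pose F (m : 'I_N) := `|\sum_(j < N) window C L r j * (z * w ^+ m) ^+ j| ^+ 2
  + `|\sum_(j < N) window C L r j * (z^* * w ^+ m) ^+ j| ^+ 2.
have total : (2 * (N%:R * W))^-1 * \sum_(m < N) F m = 1.
  rewrite big_split /= !window_total ?norm_conjC //.
  move: (mulr_gt0 N0 W0); move: (_ * _) => X X0.
  by rewrite -mulr2n -[X *+ 2]mulr_natl mulVf // gt_eqF // mulr_gt0.
rewrite rmorphB rmorph1 /= -[X in X - _ <= _]total lerBlDr.
rewrite (bigID below_threshold) /= mulrDr lerD2l.
rewrite rmorphM fmorphV rmorphXn !rmorph_nat; apply: tail => m.
rewrite /below_threshold /= -real_ltNge ?normr_real //; last first.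
  by apply/complex_realP; exists (a1 + a2).
move=> /ltW far; rewrite chord_z.
have -> : 4 = ((4%:R : R)%:C)%C by rewrite rmorph_nat.
apply: (@le_trans _ _ ((L%:R * (a2 - a1))%:C)%C); first by rewrite lecR.
rewrite rmorphM rmorph_nat ler_wpM2l ?ler0n //.
apply: (le_trans _ (real_ler_norm _)); last first.
  by rewrite rpredB ?normr_real // rpredM ?ger0_real ?ler0n // ler0c.
rewrite lerBrDr; apply: le_trans far.
have -> : 2 = ((2%:R : R)%:C)%C by rewrite rmorph_nat.
by rewrite -rmorphM -rmorphD lecR; lra.
Qed.

(** The mirror case: an accepted outcome has chord at most [a1 + a2], whereas the phase has chord
    [2 a >= 2 a2]. *)
Lemma threshold_test_rejects : a2 <= a ->
  accept_prob threshold_test H <= r%:R / 4 ^+ r.-1.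
Proof.
move=> aa2; rewrite -lecR (clock_accept_probE e_orth w below_threshold L_gt0
  U_unitary U_inverse a_ge0 a_norm).
have [z1 chord_z] := phase_norm e_orth U_unitary a_ge0 a_norm.
rewrite [leRHS]rmorphM fmorphV [in leRHS]rmorphXn !rmorph_nat.
apply: double_window_tail => // m /= far; rewrite chord_z distrC.
have -> : 4 = ((4%:R : R)%:C)%C by rewrite rmorph_nat.
apply: (@le_trans _ _ ((L%:R * (a2 - a1))%:C)%C); first by rewrite lecR.
rewrite rmorphM rmorph_nat ler_wpM2l ?ler0n //.
apply: (le_trans _ (real_ler_norm _)); last first.
  by rewrite rpredB ?normr_real // rpredM ?ger0_real ?ler0n // ler0c.
rewrite lerBrDr; apply: le_trans (lerD (lexx _) far) _.
have -> : 2 = ((2%:R : R)%:C)%C by rewrite rmorph_nat.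
by rewrite -rmorphM -rmorphD lecR; lra.
Qed.

End ThresholdTest.

(** * Pauli matrices *)

Section Bits.

Lemma bitS j x : bit j.+1 x = bit j x./2.
Proof. by rewrite /bit -divn2 -divnMA expnS. Qed.

Lemma bits_inj n x y : (x < 2 ^ n)%N -> (y < 2 ^ n)%N ->
  (forall j, (j < n)%N -> bit j x = bit j y) -> x = y.
Proof.
elim: n x y => [|n IH] x y.
  by rewrite !expn0 !ltnS !leqn0 => /eqP -> /eqP ->.
rewrite expnS => xn yn bits.
have xy0 : odd x = odd y by have := bits 0%N isT; rewrite /bit expn0 !divn1.
have xy : x./2 = y./2.
  apply: IH => [||j jn]; first by lia.
    by lia.
  by rewrite -!bitS bits.
by rewrite -[x]odd_double_half -[y]odd_double_half xy0 xy.
Qed.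

Variable n : nat.

Definition bits (x : 'I_(2 ^ n)) : {ffun 'I_n -> bool} := [ffun j : 'I_n => bit j x].

Lemma bits_bij : bijective bits.
Proof.
apply: inj_card_bij; last by rewrite card_ffun card_bool !card_ord.
move=> x y /ffunP xy; apply/val_inj/(bits_inj (ltn_ord x) (ltn_ord y)) => j jn.
by have := xy (Ordinal jn); rewrite !ffunE.
Qed.

(** Indices correspond bijectively to bit vectors, so the sum distributes over the product: a sum
    over the entries of a tensor product is the product of the sums over its factors. *)
Lemma sum_prod_bits (K : comPzSemiRingType) (F : 'I_n -> bool -> bool -> K) :
  \sum_(x < 2 ^ n) \sum_(y < 2 ^ n) \prod_j F j (bit j x) (bit j y)
  = \prod_j \sum_a \sum_b F j a b.
Proof.
rewrite bigA_distr_bigA (reindex bits) /=; last exact: onW_bij bits_bij.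
apply: eq_bigr => x _; rewrite bigA_distr_bigA (reindex bits) /=; last first.
  exact: onW_bij bits_bij.
by apply: eq_bigr => y _; apply: eq_bigr => j _; rewrite !ffunE.
Qed.

End Bits.

Section Pauli.
Variable R : realType.
Local Notation C := R[i].
Variable n : nat.
Local Notation D := (2 ^ n)%N.

Lemma pauli1_orth (P Q : 'I_4) :
  \sum_a \sum_b (pauli1_entry R P a b)^* * pauli1_entry R Q a b
  = if P == Q then 2 else 0.
Proof.
have ic : (iC R)^* = - iC R.
  by rewrite -conjcE /iC; apply/eqP; rewrite eq_complex /= oppr0 !eqxx.
have ii : iC R * iC R = -1 by rewrite -expr2; exact: sqr_i.
rewrite !big_bool.
case: P Q => [[|[|[|[|//]]]] ?] [[|[|[|[|//]]]] ?];
  rewrite /eq_op /= ?rmorphN ?conjC1 ?conjC0 /= ?ic;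
  rewrite ?(mul0r, mulr0, add0r, addr0, mulr1, mul1r, mulrN, mulNr, opprK, ii, subrr) //.
all: by rewrite ?conjC1 addrC ?subrr.
Qed.

Lemma pauli_orth (P Q : pstring n) :
  hs (pauli R P) (pauli R Q) = if P == Q then D%:R else 0.
Proof.
pose F j a b := (pauli1_entry R (P j) a b)^* * pauli1_entry R (Q j) a b.
transitivity (\prod_j \sum_a \sum_b F j a b).
  rewrite -sum_prod_bits; apply: eq_bigr => x _; apply: eq_bigr => y _.
  by rewrite !mxE rmorph_prod -big_split.
under eq_bigr do rewrite pauli1_orth.
case: eqP => [->|/eqP PQ].
  under eq_bigr do rewrite eqxx.
  by rewrite prodr_const card_ord natrX.
have [j Pj] : exists j, P j != Q j.
  apply/existsP; apply: contraR PQ; rewrite negb_exists => /forallP PQ.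
  by apply/eqP/ffunP => j; apply/eqP; have := PQ j; rewrite negbK.
by rewrite (bigD1 j) //= (negPf Pj) mul0r.
Qed.

Lemma pauli_id : pauli R [ffun _ : 'I_n => ord0] = 1%:M.
Proof.
apply/matrixP => x y; rewrite !mxE.
have [->|xy] := eqVneq x y.
  by rewrite big1 // => j _; rewrite ffunE /= eqxx.
have [j xyj] : exists j : 'I_n, bit j x != bit j y.
  apply/existsP; apply: contraR xy; rewrite negb_exists => /forallP xy.
  apply/eqP/val_inj/(bits_inj (ltn_ord x) (ltn_ord y)) => j jn.
  by apply/eqP; have := xy (Ordinal jn); rewrite negbK.
by rewrite (bigD1 j) //= ffunE /= (negPf xyj) mul0r.
Qed.

Variable k : nat.

Definition local_pauli : pred (pstring n) := fun P => (pweight P <= k)%N.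
Local Notation proj_local := (hs_proj (@pauli R n) (D%:R : C) local_pauli).

(** This makes the projection of [H] an admissible [K] in the distance to the [k]-local matrices, as
    the far case requires. *)
Lemma proj_local_klocal A : klocal k (proj_local A).
Proof.
exists (fun P => if local_pauli P then D%:R^-1 * hs (pauli R P) A else 0); split.
  rewrite /hs_proj big_mkcond; apply: eq_bigr => P _.
  by case: ifP; rewrite ?scale0r.
by move=> P; rewrite ltnNge /local_pauli => /negPf ->.
Qed.

Lemma proj_local_id K : klocal k K -> proj_local K = K.
Proof.
move=> [alpha [-> alpha0]]; apply: (proj_span (dim_gt0 R n) pauli_orth) => P.
by rewrite /local_pauli -ltnNge; exact: alpha0.
Qed.

(** The identity is the Pauli string of weight 0. It is the zeroth-order term of the evolution, so
    that term has no nonlocal part. *)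
Lemma klocal1 : klocal k (1%:M : 'M[C]_D).
Proof.
exists (fun P => if P == [ffun _ : 'I_n => ord0] then 1 else 0); split.
  rewrite (bigD1 [ffun _ : 'I_n => ord0]) //= eqxx scale1r pauli_id big1 ?addr0 //.
  by move=> P /negPf ->; rewrite scale0r.
move=> P; case: eqP => // ->; rewrite /pweight.
have -> : #|[set j | [ffun _ : 'I_n => @ord0 3] j != ord0]| = 0%N; last by [].
by apply: eq_card0 => j; rewrite !inE ffunE eqxx.
Qed.

End Pauli.

(** * Evolution of a bounded Hamiltonian for a short time *)

Section TrigBounds.
Variable R : realType.
Implicit Types x y : R.

Lemma ger0_sin_le y : 0 <= y -> `|sin y| <= y.
Proof.
move=> y0.
have cont : {within `[0, y], continuous (@sin R)}%classic.
  by apply: continuous_subspaceT; exact: continuous_sin.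
have [c _] := MVT_segment y0 (fun x _ => is_derive_sin x) cont.
rewrite sin0 !subr0 => ->; rewrite normrM (ger0_norm y0).
by rewrite ler_piMl // cos_max.
Qed.

Lemma one_minus_cos y : 0 <= y -> 0 <= 1 - cos y <= y ^+ 2 / 2.
Proof.
move=> y0; rewrite subr_ge0 cos_le1 /=.
have -> : 1 - cos y = 2 * sin (y / 2) ^+ 2.
  have -> : cos y = cos (y / 2 *+ 2) by congr (cos _); rewrite -mulr_natr mulfVK.
  by rewrite cos_mulr2n sin2cos2; ring.
have : `|sin (y / 2)| ^+ 2 <= (y / 2) ^+ 2.
  by rewrite lerXn2r ?nnegrE ?divr_ge0 // ger0_sin_le // divr_ge0.
by rewrite real_normK ?num_real //; lra.
Qed.

Lemma sub_sin y : 0 <= y -> `|y - sin y| <= y * (y ^+ 2 / 2).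
Proof.
move=> y0; pose f x := x - sin x.
have cont : {within `[0, y], continuous f}%classic.
  apply: continuous_subspaceT => x; apply: cvgB; first exact: cvg_id.
  exact: continuous_sin.
have df x : x \in `]0, y[ -> is_derive x 1 f (1 - cos x) by move=> _; exact: is_deriveB.
have [c] := MVT_segment y0 df cont.
rewrite in_itv /= /f sin0 !subr0 => /andP[c0 cy] ->.
have /andP[h1 h2] := one_minus_cos c0.
rewrite mulrC normrM (ger0_norm y0) (ger0_norm h1) ler_wpM2l //.
apply: le_trans h2 _; rewrite ler_pM2r ?invr_gt0 ?ltr0n //.
by rewrite lerXn2r ?nnegrE.
Qed.

(** The square of [|exp(i y) - 1 - i y| <= y^2]. Each of the two squares is at most [(y^2 / 2)^2];
    for the sine this uses [|y| <= 1] to weaken a cubic bound to a quadratic one. *)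
Lemma exp_remainder y : `|y| <= 1 ->
  (cos y - 1) ^+ 2 + (sin y - y) ^+ 2 <= y ^+ 4.
Proof.
wlog y0 : y / 0 <= y => [WL|].
  have [/WL//|/ltW y0 y1] := leP 0 y.
  have := WL (- y); rewrite normrN oppr_ge0 cosN sinN => /(_ y0 y1).
  by rewrite -opprD !sqrrN ![_ ^+ 4](exprM _ 2 2) sqrrN.
rewrite ger0_norm // => y1.
have /andP[h1 h2] := one_minus_cos y0.
have h3 : (1 - cos y) ^+ 2 <= (y ^+ 2 / 2) ^+ 2.
  by rewrite lerXn2r ?nnegrE ?divr_ge0 ?exprn_ge0.
have h4 : (y - sin y) ^+ 2 <= (y ^+ 2 / 2) ^+ 2.
  rewrite -[leLHS]real_normK ?num_real // lerXn2r ?nnegrE ?divr_ge0 ?exprn_ge0 //.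
  by apply: le_trans (sub_sin y0) _; rewrite ler_piMl // divr_ge0 ?exprn_ge0.
have -> : (cos y - 1) ^+ 2 + (sin y - y) ^+ 2 = (1 - cos y) ^+ 2 + (y - sin y) ^+ 2 by ring.
apply: le_trans (lerD h3 h4) _.
have : 0 <= y ^+ 4 by rewrite exprn_ge0.
have -> : (y ^+ 2 / 2) ^+ 2 = y ^+ 4 / 4 by field.
lra.
Qed.

End TrigBounds.

Section Triangle.
Variables (C : numClosedFieldType) (m p : nat).

Lemma hs_triangle (A B : 'M[C]_(m, p)) :
  sqrtC (hs (A + B) (A + B)) <= sqrtC (hs A A) + sqrtC (hs B B).
Proof.
have E (X : 'M[C]_(m, p)) : hs X X = dotmx (mxvec X) (mxvec X).
  rewrite dotmxE mxE hsE (reindex _ (curry_mxvec_bij _ _)) /= pair_big /=.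
  by apply: eq_bigr => -[i j] _; rewrite !mxE !mxvecE normCK.
rewrite !E linearD; exact: (triangle_lerif (@dotmx C _) (mxvec A) (mxvec B)).1.
Qed.

End Triangle.

(** * The matrix exponential of a Hermitian matrix in its eigenbasis *)

Section Exponential.
Variable R : realType.
Local Notation C := R[i].

Definition phase (x : R) : C := Complex (cos x) (sin x).

Lemma Re_sum I (s : seq I) (F : I -> C) :
  complex.Re (\sum_(i <- s) F i) = \sum_(i <- s) complex.Re (F i).
Proof. by apply: big_morph => // -[a b] [a' b']. Qed.

Lemma Im_sum I (s : seq I) (F : I -> C) :
  complex.Im (\sum_(i <- s) F i) = \sum_(i <- s) complex.Im (F i).
Proof. by apply: big_morph => // -[a b] [a' b']. Qed.

Lemma exp_coef_i (x : R) j : (j`!%:R)^-1 * (iC R * (x%:C)%C) ^+ j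
  = Complex (cos_coeff x j) (sin_coeff x j).
Proof.
have ii : iC R ^+ 2 = -1 by exact: sqr_i.
rewrite exprMn -rmorphXn -(rmorph_nat (real_complex R)) -fmorphV.
have -> : iC R ^+ j = iC R ^+ odd j * (((-1) ^+ j./2 : R)%:C)%C.
  by rewrite -{1}[j]odd_double_half exprD -mul2n exprM ii rmorphXn rmorphN1.
rewrite /cos_coeff /sin_coeff /= -exprnP; case: (boolP (odd j)) => oj /=.
  have -> : j.-1./2 = j./2 by lia.
  by apply/eqP; rewrite eq_complex /=; apply/andP; split; apply/eqP; ring.
by apply/eqP; rewrite eq_complex /=; apply/andP; split; apply/eqP; ring.
Qed.

Lemma exp_series_i (x : R) N :
  \sum_(j < N) (j`!%:R)^-1 * (iC R * (x%:C)%C) ^+ j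
  = Complex (series (cos_coeff x) N) (series (sin_coeff x) N).
Proof.
rewrite /series /= !big_mkord; under eq_bigr do rewrite exp_coef_i.
by apply/eqP; rewrite eq_complex /= Re_sum Im_sum !eqxx.
Qed.

Lemma cvg_sumr (I : finType) (F : I -> nat -> R) (l : I -> R) :
  (forall i, (F i @ \oo --> l i)%classic) ->
  ((fun N => \sum_i F i N) @ \oo --> \sum_i l i)%classic.
Proof.
move=> Fl; apply: (@cvg_big R I +%R 0 predT _ _ _ (index_enum I) F l) => //.
exact: add_continuous.
Qed.

Section Diagonal.
Variables (m : nat) (Q : 'M[C]_m).
Hypothesis Q_unitary : Q *m adjmx Q = 1%:M.

Definition diagonalized (c : 'I_m -> C) : 'M[C]_m :=
  adjmx Q *m diag_mx (\row_l c l) *m Q.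

Lemma diagonalizedE c i j :
  diagonalized c i j = \sum_l (Q l i)^* * Q l j * c l.
Proof.
by rewrite mxE; apply: eq_bigr => l _; rewrite mul_mx_diag !mxE mulrAC.
Qed.

Lemma diagonalizedM c c' :
  diagonalized c *m diagonalized c' = diagonalized (fun l => c l * c' l).
Proof.
rewrite /diagonalized !mulmxA -[_ *m Q *m adjmx Q]mulmxA Q_unitary mulmx1.
rewrite -[adjmx Q *m diag_mx _ *m diag_mx _]mulmxA mulmx_diag.
by congr (_ *m diag_mx _ *m _); apply/rowP => l; rewrite !mxE.
Qed.

Lemma diagonalized1 : diagonalized (fun=> 1) = 1%:M.
Proof.
rewrite /diagonalized (_ : diag_mx _ = 1%:M) ?mulmx1 ?(mulmx1C Q_unitary) //.
by apply/matrixP => i j; rewrite !mxE.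
Qed.

Lemma diagonalizedB c c' :
  diagonalized c - diagonalized c' = diagonalized (fun l => c l - c' l).
Proof.
apply/matrixP => i j; rewrite [LHS]mxE [X in _ + X]mxE !diagonalizedE -sumrB.
by apply: eq_bigr => l _; rewrite mulrBr.
Qed.

Lemma diagonalizedZ a c : a *: diagonalized c = diagonalized (fun l => a * c l).
Proof.
apply/matrixP => i j; rewrite [LHS]mxE !diagonalizedE mulr_sumr.
by apply: eq_bigr => l _; rewrite mulrCA.
Qed.

Lemma adj_diagonalized c : adjmx (diagonalized c) = diagonalized (fun l => (c l)^*).
Proof.
apply/matrixP => i j; rewrite adjmxE !diagonalizedE rmorph_sum.
by apply: eq_bigr => l _; rewrite !rmorphM /= conjCK [Q l j * _]mulrC.
Qed.

Lemma hs_diagonalized c :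
  hs (diagonalized c) (diagonalized c) = \sum_l `|c l| ^+ 2.
Proof.
rewrite hs_trace adj_diagonalized diagonalizedM /diagonalized mxtrace_mulC mulmxA.
rewrite Q_unitary mul1mx mxtrace_diag; apply: eq_bigr => l _.
by rewrite !mxE normCK mulrC.
Qed.

Lemma mxpow_diagonalized c j :
  mxpow (diagonalized c) j = diagonalized (fun l => c l ^+ j).
Proof.
elim: j => [|j IH]; first by rewrite /mxpow /= -diagonalized1.
rewrite /mxpow iterS -/(mxpow _ _) IH diagonalizedM.
by congr diagonalized; apply/funext => l; rewrite exprS.
Qed.

(** Every entry of a partial sum is a finite combination of partial cosine and sine series, so its
    real and imaginary parts, whose limits [expmx] takes separately, converge entrywise. *)
Lemma expmx_diagonalized (x : 'I_m -> R) :
  expmx (diagonalized (fun l => iC R * (x l)%:C%C)) = diagonalized (fun l => phase (x l)).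
Proof.
have partialE N i j : exp_partial (diagonalized (fun l => iC R * (x l)%:C%C)) N i j
  = \sum_l (Q l i)^* * Q l j *
      Complex (series (cos_coeff (x l)) N) (series (sin_coeff (x l)) N).
  rewrite /exp_partial summxE.
  transitivity (\sum_(k < N) \sum_l (Q l i)^* * Q l j *
     ((k`!%:R)^-1 * (iC R * (x l)%:C%C) ^+ k)).
    apply: eq_bigr => k _; rewrite mxE mxpow_diagonalized diagonalizedE mulr_sumr.
    by apply: eq_bigr => l _; rewrite mulrCA.
  rewrite exchange_big; apply: eq_bigr => l _ /=.
  by rewrite -mulr_sumr exp_series_i.
have cosl l : (series (cos_coeff (x l)) @ \oo --> cos (x l))%classic.
  by rewrite unlock; exact: is_cvg_series_cos_coeff.
have sinl l : (series (sin_coeff (x l)) @ \oo --> sin (x l))%classic.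
  by rewrite unlock; exact: is_cvg_series_sin_coeff.
apply/matrixP => i j; rewrite mxE diagonalizedE.
pose al l := (Q l i)^* * Q l j.
apply/eqP; rewrite eq_complex /= Re_sum Im_sum; apply/andP; split; apply/eqP.
  apply/cvg_lim => //.
  rewrite (_ : (fun N => _) = (fun N => \sum_l
     (complex.Re (al l) * series (cos_coeff (x l)) N
      - complex.Im (al l) * series (sin_coeff (x l)) N))); last first.
    apply/funext => N; rewrite partialE Re_sum; apply: eq_bigr => l _.
    by rewrite -/(al l); case: (al l).
  rewrite (eq_bigr (fun l => complex.Re (al l) * cos (x l) - complex.Im (al l) * sin (x l))).
    by apply: cvg_sumr => l; apply: cvgB; apply: cvgMr.
  by move=> l _; rewrite -/(al l); case: (al l).
apply/cvg_lim => //.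
rewrite (_ : (fun N => _) = (fun N => \sum_l
   (complex.Re (al l) * series (sin_coeff (x l)) N
    + complex.Im (al l) * series (cos_coeff (x l)) N))); last first.
  apply/funext => N; rewrite partialE Im_sum; apply: eq_bigr => l _.
  by rewrite -/(al l); case: (al l).
rewrite (eq_bigr (fun l => complex.Re (al l) * sin (x l) + complex.Im (al l) * cos (x l))).
  by apply: cvg_sumr => l; apply: cvgD; apply: cvgMr.
by move=> l _; rewrite -/(al l); case: (al l).
Qed.

End Diagonal.

Lemma hermitian_diagonalized m (H : 'M[C]_m) : is_hermitian H ->
  exists Q : 'M[C]_m, exists lam : 'I_m -> R,
    Q *m adjmx Q = 1%:M /\ H = diagonalized Q (fun l => (lam l)%:C%C).
Proof.
move=> hermH.
have Hh : H \is hermsymmx by apply/is_hermitianmxP; rewrite expr0 scale1r; exact: esym.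
have := hermitian_spectral_diag_real Hh.
have /orthomx_spectralP := hermitian_normalmx Hh.
move: (spectralmx H) (spectral_diag H) (spectral_unitarymx H) => Q sp Qu.
rewrite invmx_unitary // => HE /mxOverP sp_real.
exists Q, (fun l => complex.Re (sp 0 l)); split; first exact/unitarymxP.
rewrite /diagonalized (_ : \row_l _ = sp) //.
by apply/rowP => l; rewrite mxE RRe_real.
Qed.

(** Column [l] of [adjmx Q] is a unit eigenvector for [lam l]; the norm bound is applied to it. *)
Lemma opnorm_eigenvalue m (Q : 'M[C]_m) (lam : 'I_m -> R) :
  Q *m adjmx Q = 1%:M -> opnorm_le1 (diagonalized Q (fun l => (lam l)%:C%C)) ->
  forall l, `|lam l| <= 1.
Proof.
move=> Qu op l.
have vnormE (v : 'cV[C]_m) : ((vnorm2 v)%:C)%C = hs v v.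
  rewrite rmorph_sum hsE; apply: eq_bigr => i _.
  by rewrite big_ord1; exact: abs2E.
pose v : 'cV[C]_m := col l (adjmx Q).
have v1 : hs v v = 1.
  transitivity ((Q *m adjmx Q) l l); last by rewrite Qu mxE eqxx.
  by rewrite hsE mxE; apply: eq_bigr => i _; rewrite big_ord1 !mxE conjcE norm_conjC normCK.
have Hv : diagonalized Q (fun l => (lam l)%:C%C) *m v = (lam l)%:C%C *: v.
  rewrite /v !colE mulmxA -[_ *m Q *m adjmx Q]mulmxA Qu mulmx1 -!colE.
  by apply/colP => k; rewrite mxE mul_mx_diag !mxE mulrC.
have := op v; rewrite -lecR !vnormE Hv hsZl hsZr v1 mulr1 mulrC -normCK => h.
rewrite -(@expr_le1 _ 2) // -lecR; apply: le_trans h; rewrite rmorphXn /=.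
by rewrite normc_def /= expr0n addr0 sqrtr_sqr.
Qed.

Section Evolution.
Variables (m : nat) (H : 'M[C]_m) (t : R).
Hypothesis H_hermitian : is_hermitian H.

Lemma evol_diagonalized Q lam : Q *m adjmx Q = 1%:M ->
    H = diagonalized Q (fun l => (lam l)%:C%C) ->
  evol H t = diagonalized Q (fun l => phase (- (t * lam l))) /\
  evol_inv H t = diagonalized Q (fun l => phase (t * lam l)).
Proof.
move=> Qu HE.
have expE (s : R) : expmx ((iC R * s%:C%C) *: H)
    = diagonalized Q (fun l => phase (s * lam l)).
  rewrite HE diagonalizedZ -(expmx_diagonalized Qu (fun l => s * lam l)).
  congr (expmx (diagonalized Q _)); apply/funext => l.
  by rewrite -mulrA -rmorphM.
split; last exact: expE.
rewrite /evol (_ : - (iC R * t%:C%C) = iC R * (- t)%:C%C); last first.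
  by rewrite (rmorphN (real_complex R)) mulrN.
rewrite expE; congr (diagonalized Q _); apply/funext => l.
by rewrite mulNr.
Qed.

Lemma phase_unit x : phase x * (phase x)^* = 1.
Proof.
rewrite -normCK -add_Re2_Im2 /= cos2Dsin2.
by [].
Qed.

Lemma phase_conj x : (phase x)^* = phase (- x).
Proof. by rewrite /phase cosN sinN. Qed.

Lemma evol_unitary : evol H t *m adjmx (evol H t) = 1%:M.
Proof.
have [Q [lam [Qu HE]]] := hermitian_diagonalized H_hermitian.
have [-> _] := evol_diagonalized Qu HE.
rewrite adj_diagonalized diagonalizedM // -(diagonalized1 Qu).
by congr diagonalized; apply/funext => l; rewrite phase_unit.
Qed.

Lemma evol_invE : evol_inv H t = adjmx (evol H t).
Proof.
have [Q [lam [Qu HE]]] := hermitian_diagonalized H_hermitian.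
have [-> ->] := evol_diagonalized Qu HE.
rewrite adj_diagonalized.
by congr diagonalized; apply/funext => l; rewrite phase_conj opprK.
Qed.

Hypothesis H_bounded : opnorm_le1 H.
Hypothesis t_ge0 : 0 <= t.
Hypothesis t_le1 : t <= 1.

(** In the eigenbasis this is the first-order Taylor remainder of the exponential at each
    [- t * lam l], a number of modulus at most [t <= 1]. *)
Lemma evol_remainder (E := evol H t - (1%:M - (iC R * t%:C%C) *: H)) :
  hs E E <= m%:R * (t%:C%C) ^+ 4.
Proof.
have [Q [lam [Qu HE]]] := hermitian_diagonalized H_hermitian.
have [evolE _] := evol_diagonalized Qu HE.
have lam1 : forall l, `|lam l| <= 1.
  by apply: (opnorm_eigenvalue Qu); rewrite -HE.
have EE : E = diagonalized Q (fun l =>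
    phase (- (t * lam l)) - (1 - iC R * t%:C%C * (lam l)%:C%C)).
  by rewrite /E evolE [in X in _ - X]HE -(diagonalized1 Qu) diagonalizedZ !diagonalizedB.
rewrite EE hs_diagonalized // -[m in leRHS]card_ord -sum1_card natr_sum mulr_suml.
apply: ler_sum => l _; rewrite mul1r -add_Re2_Im2 -(rmorphXn (real_complex R)) lecR /=.
set y := - (t * lam l).
have y1 : `|y| <= 1.
  by rewrite normrN normrM ger0_norm // mulr_ile1.
have yt : y ^+ 4 <= t ^+ 4.
  rewrite -[y ^+ 4]ger0_norm ?normrX; last by rewrite (exprM _ 2 2) sqr_ge0.
  rewrite lerXn2r ?nnegrE // normrN normrM ger0_norm //.
  by rewrite ler_piMr.
apply: le_trans yt; apply: le_trans (exp_remainder y1).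
rewrite le_eqVlt; apply/orP; left; apply/eqP.
by congr (_ ^+ 2 + _ ^+ 2); rewrite /y; ring.
Qed.

End Evolution.
End Exponential.

(** * The amplitude outside the local Paulis *)

Section NormalizedFrobenius.
Variables (R : realType) (n : nat).
Local Notation C := R[i].
Local Notation D := (2 ^ n)%N.
Implicit Types A B : 'M[C]_D.

Lemma nfrob_ge0 A : 0 <= nfrob A.
Proof. exact: sqrtr_ge0. Qed.

Lemma hs_nfrob A : hs A A = D%:R * ((nfrob A)%:C)%C ^+ 2.
Proof.
have D0 : 0 < D%:R :> R by rewrite ltr0n expn_gt0.
have trE : ((complex.Re (\tr (adjmx A *m A)))%:C)%C = hs A A.
  by rewrite -hs_trace RRe_real // ger0_real // hs_ge0.
have tr0 : 0 <= complex.Re (\tr (adjmx A *m A)).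
  by rewrite -ler0c trE hs_ge0.
rewrite -rmorphXn /nfrob sqr_sqrtr; last by rewrite divr_ge0 // ltW.
rewrite rmorphM fmorphV rmorph_nat /= trE mulrC divfK // pnatr_eq0 expn_eq0.
Qed.

Lemma sqrt_hs A : sqrtC (hs A A) = sqrtC D%:R * ((nfrob A)%:C)%C.
Proof.
rewrite hs_nfrob rootCMl ?ler0n // sqrCK //.
by rewrite ler0c nfrob_ge0.
Qed.

Lemma le_nfrob A B : (nfrob A <= nfrob B) = (hs A A <= hs B B).
Proof.
rewrite !hs_nfrob ler_pM2l ?dim_gt0 // -!rmorphXn lecR.
by rewrite ler_sqr ?nnegrE ?nfrob_ge0.
Qed.

Lemma nfrobD A B : nfrob (A + B) <= nfrob A + nfrob B.
Proof.
have := hs_triangle A B; rewrite !sqrt_hs -mulrDr ler_pM2l ?sqrtC_gt0 ?dim_gt0 //.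
by rewrite -rmorphD lecR.
Qed.

Lemma nfrobZ (c : C) (s : R) A : 0 <= s -> `|c| = (s%:C)%C ->
  nfrob (c *: A) = s * nfrob A.
Proof.
move=> s0 cs; apply/eqP; rewrite -(@eqrXn2 _ 2) ?mulr_ge0 ?nfrob_ge0 //.
apply/eqP; apply: (@complexI R); rewrite !rmorphXn rmorphM.
apply: (mulfI (lt0r_neq0 (dim_gt0 R n))).
by rewrite -hs_nfrob hsZl hsZr mulrA [_^* * _]mulrC -normCK cs hs_nfrob; ring.
Qed.

Lemma nfrobN A : nfrob (- A) = nfrob A.
Proof. by rewrite -scaleN1r (@nfrobZ _ 1) ?mul1r // normrN normr1. Qed.

Lemma nfrob_dist A B : `|nfrob A - nfrob B| <= nfrob (A + B).
Proof.
have := nfrobD (A + B) (- A); rewrite nfrobN [A + B]addrC addrK.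
have := nfrobD (B + A) (- B); rewrite nfrobN [B + A]addrC addrK => hA hB.
by rewrite ler_norml; apply/andP; split; lra.
Qed.

End NormalizedFrobenius.

Section Amplitude.
Variables (R : realType) (n k : nat).
Local Notation C := R[i].
Local Notation D := (2 ^ n)%N.

Definition nonlocal_part (A : 'M[C]_D) : 'M[C]_D :=
  A - hs_proj (@pauli R n) D%:R (local_pauli k) A.

Local Notation proj_local := (hs_proj (@pauli R n) D%:R (local_pauli k)).

Lemma nonlocal_partB A B : nonlocal_part (A - B) = nonlocal_part A - nonlocal_part B.
Proof. by rewrite /nonlocal_part projB !opprB addrACA [RHS]addrACA [- B + _]addrC. Qed.

Lemma nonlocal_partZ c A : nonlocal_part (c *: A) = c *: nonlocal_part A.
Proof. by rewrite /nonlocal_part projZ scalerBr. Qed.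

Lemma nonlocal_part_klocal K : klocal k K -> nonlocal_part K = 0.
Proof. by move=> /proj_local_id KE; rewrite /nonlocal_part KE subrr. Qed.

Lemma nfrob_nonlocal_part_le A : nfrob (nonlocal_part A) <= nfrob A.
Proof. by rewrite le_nfrob; exact: (hs_compl_le _ (dim_gt0 R n) (@pauli_orth R n)). Qed.

(** Subtracting [K] does not change the nonlocal part, and taking that part does not increase the
    norm. With [proj_local_klocal], the norm of the nonlocal part is the distance of [H] to the
    [k]-local matrices. *)
Lemma nfrob_nonlocal_part_dist H K : klocal k K ->
  nfrob (nonlocal_part H) <= nfrob (H - K).
Proof.
move=> Kk; rewrite -[nonlocal_part H]subr0 -(nonlocal_part_klocal Kk) -nonlocal_partB.
exact: nfrob_nonlocal_part_le.
Qed.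

(** In [exp(-iHt) = 1 - i t H + E] the identity is local, so the nonlocal parts of the evolution and
    of [- i t H] differ by that of [E], whose norm is at most [t ^+ 2]. *)
Lemma evol_amplitude (H : 'M[C]_D) (t : R) :
    is_hermitian H -> opnorm_le1 H -> 0 <= t -> t <= 1 ->
  `| nfrob (nonlocal_part (evol H t)) - t * nfrob (nonlocal_part H) | <= t ^+ 2.
Proof.
move=> Hh Hb t0 t1.
set E := evol H t - (1%:M - (iC R * t%:C%C) *: H).
have EE : nfrob (nonlocal_part E) <= t ^+ 2.
  apply: le_trans (nfrob_nonlocal_part_le _) _.
  have : hs E E <= D%:R * t%:C%C ^+ 4 by exact: evol_remainder.
  rewrite hs_nfrob.
  rewrite ler_pM2l ?dim_gt0 // -!rmorphXn lecR (exprM t 2 2) => h.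
  by move: h; rewrite ler_sqr ?nnegrE ?nfrob_ge0 ?exprn_ge0.
have cn : `|iC R * t%:C%C| = t%:C%C.
  rewrite normrM (_ : `|iC R| = 1) ?mul1r; last exact: normCi.
  by rewrite ger0_norm // ler0c.
have UE : nonlocal_part E =
    nonlocal_part (evol H t) + (iC R * t%:C%C) *: nonlocal_part H.
  rewrite /E !nonlocal_partB nonlocal_partZ (nonlocal_part_klocal (klocal1 R n k)).
  by rewrite sub0r opprK.
rewrite -(nfrobZ _ t0 cn); apply: le_trans EE; rewrite UE.
exact: nfrob_dist.
Qed.

End Amplitude.

(** * The query-free algorithm for large error probabilities *)

Section Coin.
Variables (R : realType) (n : nat).
Local Notation C := R[i].

Definition coin_index : 'I_(2 ^ n) := Ordinal (expn_gt0 2 n).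

(** As [delta] tends to 1 the allowance proportional to [ln delta^-1] drops below one query, so
    [delta >= 1/2] is served by a fair coin. The ancilla of dimension 2 supplies the coin even when
    [n = 0]. *)
Definition coin_flip : algorithm R n :=
  @Algorithm R n 2
    (\matrix_(i, a) if i == coin_index then ((Num.sqrt 2^-1)%:C)%C else 0)
    [::] 1%:M [set mxvec_index coin_index 0].

Lemma abs2_coin : abs2 (((Num.sqrt 2^-1)%:C)%C : C) = 2^-1.
Proof. by rewrite /abs2 /= expr0n addr0 sqr_sqrtr // invr_ge0. Qed.

Lemma coin_flip_valid : valid_algorithm coin_flip.
Proof.
split; [|split=> //]; last by rewrite /Defs.is_unitary adjmx1 mulmx1.
rewrite (bigD1 coin_index) //= [X in _ + X]big1 => [|i /negPf i0].
  by rewrite big_ord_recl big_ord1 !mxE eqxx abs2_coin addr0; field.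
by rewrite big1 // => a _; rewrite mxE i0 /abs2 /= expr0n addr0.
Qed.

Lemma coin_flip_prob H : accept_prob coin_flip H = 2^-1.
Proof. by rewrite /accept_prob big_set1 mulmx1 mxvecE mxE eqxx abs2_coin. Qed.

End Coin.

Lemma query_count_le L r : (0 < L)%N -> (0 < r)%N ->
  ((L.-1 * r).*2.+1 <= 2 * L * r)%N.
Proof. by case: L => // l _ r0 /=; nia. Qed.

(** * Numerical choice of the window parameters *)

Section ClockConstants.
Variable R : realType.

(** The constant 32 is what [gap] needs when [a2 - a1 = Delta ^+ 2 / 8]; rounding up adds at most
    [Delta ^+ 2 <= 1]. *)
Lemma window_length (Delta : R) : 0 < Delta -> Delta <= 1 ->
  exists L : nat, [/\ (0 < L)%N, 32 <= L%:R * Delta ^+ 2 & L%:R * Delta ^+ 2 <= 33].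
Proof.
move=> D0 D1; have D2 : 0 < Delta ^+ 2 by rewrite exprn_gt0.
have D21 : Delta ^+ 2 <= 1 by apply: exprn_ile1 => //; exact: ltW.
have x0 : 0 <= 32 / Delta ^+ 2 by rewrite divr_ge0 ?ltW.
have /andP[lo hi] := truncn_itv x0.
exists (Num.truncn (32 / Delta ^+ 2)).+1; split=> //.
  by rewrite -ler_pdivrMr // ltW.
move: lo; rewrite ler_pdivlMr // => lo.
rewrite -natr1; lra.
Qed.

(** Since [r <= 2 ^+ r], the tail is at most [4 / 2 ^+ r], so [2 ^+ r >= 4 / delta] suffices. This
    follows from [r > 2 x + 4], because [2 ^+ r >= exp(r / 2) >= exp(2 + x)] and [exp 2 >= 4]. *)
Lemma window_order (delta : R) : 0 < delta -> delta < 2^-1 ->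
  exists r : nat, [/\ (0 < r)%N, r%:R / 4 ^+ r.-1 <= delta
    & r%:R <= 12 * ln delta^-1].
Proof.
move=> d0 d12; set x := ln delta^-1.
have ex : expR x = delta^-1 by rewrite lnK // posrE invr_gt0.
(* This bound lets the additive constant be absorbed: [r <= 2 x + 5 <= 12 x]. *)
have x12 : 1 / 2 <= x.
  have h : -1 < delta - 1 by lra.
  have : ln (1 + (delta - 1)) <= delta - 1 by exact: le_ln1Dx.
  by rewrite addrCA subrr addr0 /x lnV ?posrE //; lra.
have x0 : 0 <= 2 * x + 4 by lra.
have /andP[lo hi] := truncn_itv x0.
exists (Num.truncn (2 * x + 4)).+1; split=> //; last by rewrite -natr1; lra.
move: hi; set r := (Num.truncn _).+1; have r_gt0 : (0 < r)%N by [].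
move: r r_gt0 => r r_gt0 hi.
have e2 : 2 <= expR 1 :> R by apply: le_trans (expR_ge1Dx 1); lra.
have e12 : expR (1 / 2) <= 2 :> R.
  have h : 1 + - (1 / 2) <= expR (- (1 / 2)) :> R := expR_ge1Dx _.
  have : expR (1 / 2) * expR (- (1 / 2)) = 1 :> R by exact: expRxMexpNx_1.
  have := expR_gt0 (1 / 2 : R); nra.
have two_r : 4 / delta <= 2 ^+ r.
  apply: (@le_trans _ _ (expR (1 / 2) ^+ r)); last by rewrite lerXn2r ?nnegrE ?expR_ge0.
  rewrite -expRM_natl.
  apply: (@le_trans _ _ (expR (2 + x))); last by rewrite ler_expR; lra.
  have dV : 0 <= delta^-1 by rewrite invr_ge0 ltW.
  rewrite expRD ex ler_wpM2r //.
  have -> : expR 2 = expR 1 * expR 1 :> R by rewrite -expRD.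
  have := ler_pM (ler0n _ 2) (ler0n _ 2) e2 e2; lra.
have r2 : r%:R <= 2 ^+ r :> R by rewrite -natrX ler_nat ltnW // ltn_expl.
have p0 : 0 < 2 ^+ r :> R by rewrite exprn_gt0.
have -> : 4 ^+ r.-1 = 2 ^+ r * 2 ^+ r / 4 :> R.
  rewrite -exprMn (_ : 2 * 2 = 4); last by rewrite -natrM.
  by rewrite -[in RHS](prednK r_gt0) exprSr mulfK.
rewrite ler_pdivrMr; last by rewrite divr_gt0 ?mulr_gt0.
move: two_r; rewrite ler_pdivrMr // => two_r.
nra.
Qed.

End ClockConstants.

Theorem theorem1p4 (R : realType) :
  exists c : R, 0 < c /\
  forall (eps1 eps2 delta : R) (k n : nat),
    0 <= eps1 -> eps1 < eps2 -> eps2 <= 1 -> 0 < delta -> delta < 1 ->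
    exists A : algorithm R n,
      valid_algorithm A /\
      (num_queries A)%:R <= c * (ln (delta^-1) / (eps2 - eps1) ^+ 2) /\
      total_time A <= c * (ln (delta^-1) / (eps2 - eps1)) /\
      forall H : 'M[R[i]]_(2 ^ n),
        is_hermitian H -> opnorm_le1 H ->
        ((exists K, klocal k K /\ nfrob (H - K) <= eps1) ->
           1 - delta <= accept_prob A H) /\
        ((forall K, klocal k K -> eps2 <= nfrob (H - K)) ->
           accept_prob A H <= delta).
Proof.
(* [792 = 2 * 33 * 12]: there are at most [2 L r] queries, with [L * Delta ^+ 2 <= 33] and
   [r <= 12 * ln delta^-1]. *)
have [c [c0 cE]] : exists c : R, 0 < c /\ c = 792.
  by exists 792; split; first by rewrite ltr0n.
exists c; split=> //.
move=> eps1 eps2 delta k n e1 e12 e2 d0 d1.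
have lnd : 0 <= ln delta^-1 by rewrite ln_ge0 // invf_ge1 // ltW.
have D0 : 0 < eps2 - eps1 by rewrite subr_gt0.
have [d12|d12] := leP 2^-1 delta.
  exists (coin_flip R n); split; first exact: coin_flip_valid.
  split; first by rewrite mulr_ge0 ?divr_ge0 ?exprn_ge0 // ltW.
  split; first by rewrite /total_time big_nil mulr_ge0 ?divr_ge0 // ltW.
  by move=> H _ _; rewrite coin_flip_prob; split=> // _; lra.
have D1 : eps2 - eps1 <= 1 by lra.
have [L [L0 Llo Lhi]] := window_length D0 D1.
have [r [r0 rdelta rhi]] := window_order d0 d12.
have [w w_prim] := closed_prim_root_exists R[i] (ltn0Sn (L.-1 * r)).
set Delta := eps2 - eps1 in D0 D1 Llo Lhi *.
(* This time maximises the gap [a2 - a1 = t * Delta - 2 * t ^+ 2], with value [Delta ^+ 2 / 8]. *)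
pose t := Delta / 4.
have t0 : 0 <= t by rewrite divr_ge0 // ltW.
have t1 : t <= 1 by rewrite /t; lra.
(* By [evol_amplitude] the amplitude is [t] times the distance up to [t ^+ 2], so these are the
   extreme amplitudes of the close and far cases. *)
pose a1 := t * eps1 + t ^+ 2; pose a2 := t * eps2 - t ^+ 2.
have gap : 4 <= L%:R * (a2 - a1).
  have -> : a2 - a1 = Delta ^+ 2 / 8 by rewrite /a1 /a2 /t /Delta; field.
  by rewrite mulrA ler_pdivlMr // -natrM.
exists (threshold_test (@pauli R n) (local_pauli k) L r w t a1 a2).
have queries : (L.-1 * r).*2.+1%:R <= c * (ln delta^-1 / Delta ^+ 2).
  rewrite mulrA ler_pdivlMr ?exprn_gt0 //.
  apply: (@le_trans _ _ ((2 * L * r)%N%:R * Delta ^+ 2)).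
    rewrite ler_wpM2r ?exprn_ge0 ?(ltW D0) // ler_nat.
    exact: query_count_le.
  rewrite !natrM.
  have -> : 2 * L%:R * r%:R * Delta ^+ 2 = 2 * (L%:R * Delta ^+ 2) * r%:R by ring.
  apply: (@le_trans _ _ (2 * 33 * r%:R)); first by rewrite ler_wpM2r // ler_wpM2l.
  by rewrite cE; lra.
split; first by apply: clock_algorithm_valid => //; exact: pauli_orth.
split; first by rewrite clock_num_queries.
split.
  (* Every query lasts [t = Delta / 4], which cancels one factor [Delta] of the query bound. *)
  rewrite clock_total_time; apply: le_trans (ler_wpM2l t0 queries) _.
  rewrite (_ : t * _ = c / 4 * (ln delta^-1 / Delta)); last first.
    by rewrite /t; field; rewrite lt0r_neq0.
  by rewrite ler_wpM2r ?divr_ge0 ?(ltW D0) //; lra.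
move=> H Hh Hb.
have U_unitary := evol_unitary t Hh.
have U_inverse := evol_invE t Hh.
have := evol_amplitude k Hh Hb t0 t1; rewrite ler_distl => /andP[lo hi].
have a_norm := hs_nfrob (nonlocal_part k (evol H t)).
split.
  move=> [K [Kk HK]]; apply: le_trans (_ : 1 - r%:R / 4 ^+ r.-1 <= _).
    by rewrite lerD2l lerN2.
  apply: (threshold_test_accepts (@pauli_orth R n) L0 r0 w_prim gap U_unitary U_inverse
    (nfrob_ge0 _) a_norm).
  apply: (le_trans hi); rewrite lerD2r; apply: (ler_wpM2l t0).
  exact: le_trans (nfrob_nonlocal_part_dist H Kk) HK.
move=> far; apply: le_trans rdelta.
apply: (threshold_test_rejects (@pauli_orth R n) L0 r0 w_prim gap U_unitary U_inverse
  (nfrob_ge0 _) a_norm).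
(* The farness hypothesis, taken at the projection of [H], bounds the norm of its nonlocal part from
   below by [eps2]. *)
apply: le_trans lo; rewrite lerD2r; apply: (ler_wpM2l t0).
exact: far (proj_local_klocal k H).
Qed.
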